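(* Let $r$ be a positive integer and let $f(\boldsymbol{x})=g(\boldsymbol{x})\,\mathbb{I}\{\phi(\boldsymbol{x})\ge0\}$ for $\boldsymbol{x}\in\mathbb{R}^d$, with $g,\phi\in\mathcal{C}^r(\mathbb{R}^d)$. Let $j\in\{1,\dots,d\}$ be fixed and $r\ge d$. Suppose that (i) $(\partial_j\phi)(\boldsymbol{x})\ne0$ for all $\boldsymbol{x}\in\mathbb{R}^d$; (ii) there exist constants $L,A>0$ such that $$\max\left\{|(\partial^{\boldsymbol{\alpha}}g)(\boldsymbol{x})|,\ |(\partial^{\boldsymbol{\alpha}}\phi)(\boldsymbol{x})|,\ |(\partial_j\phi)(\boldsymbol{x})|^{-b}\right\}\le Le^{A|\boldsymbol{x}|}$$ for all $\boldsymbol{x}\in\mathbb{R}^d$, all integers $1\le b\le 2r-1$ and all multi-indices $\boldsymbol{\alpha}$ with $|\boldsymbol{\alpha}|\le r$. Then there exist constants $L',A'>0$ such that, for every multi-index $\boldsymbol{\alpha}$ with $|\boldsymbol{\alpha}|\le r$ and $\alpha_j=0$, the derivative $\partial^{\boldsymbol{\alpha}}P_jf$ exists on $\mathbb{R}^{d-1}$ and $$\left|(\partial^{\boldsymbol{\alpha}}P_jf)(\boldsymbol{y})\right|\le L'e^{A'|\boldsymbol{y}|}\qquad\text{for all }\boldsymbol{y}\in\mathbb{R}^{d-1},$$ where $$(P_jf)(\boldsymbol{y})=\int_{-\infty}^{\infty}f(x_j,\boldsymbol{y})\varphi(x_j)\,dx_j$$ and $\varphi$ is the one-dimensional standard normal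 density.
   Context: For $\boldsymbol{x}\in\mathbb{R}^d$, $\boldsymbol{y}=\boldsymbol{x}_{-j}\in\mathbb{R}^{d-1}$ denotes the components of $\boldsymbol{x}$ other than $x_j$, and $f(x_j,\boldsymbol{y})$ means $f(\boldsymbol{x})$. $\partial_j\phi=\partial\phi/\partial x_j$. For a multi-index $\boldsymbol{\alpha}=(\alpha_1,\dots,\alpha_d)$ of nonnegative integers, $|\boldsymbol{\alpha}|=\sum_i\alpha_i$ and $\partial^{\boldsymbol{\alpha}}=\partial^{|\boldsymbol{\alpha}|}/\partial x_1^{\alpha_1}\cdots\partial x_d^{\alpha_d}$. For vectors, $|\cdot|$ is the Euclidean norm. $\mathbb{I}$ is the indicator function. *)

(* Defs.v *)
From HB Require Import structures.
From mathcomp Require Import all_boot all_order all_algebra.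
From mathcomp Require Import all_classical all_reals all_analysis.

Set Implicit Arguments.
Unset Strict Implicit.
Unset Printing Implicit Defensive.

Import Order.TTheory GRing.Theory Num.Theory.
Import numFieldNormedType.Exports.

Local Open Scope classical_set_scope.
Local Open Scope ring_scope.

(* The library norm on 'rV[R]_n is the sup norm. *)
Definition eucl_norm (R : realType) (n : nat) (x : 'rV[R]_n) : R :=
  Num.sqrt (\sum_(i < n) x 0 i ^+ 2).

Definition partial (R : realType) (n : nat) (i : 'I_n) (f : 'rV[R]_n -> R) :
    'rV[R]_n -> R :=
  fun x => 'D_(delta_mx 0 i) f x.

(* [:: i1; ..; ik] stands for the composite d_i1 (.. (d_ik f)). *)
Definition dword (R : realType) (n : nat) (w : seq 'I_n) (f : 'rV[R]_n -> R) :
    'rV[R]_n -> R :=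
  foldr (@partial R n) f w.

(* 'D_v is a total operator, so the existence on the whole of R^n of every
   partial derivative occurring in dword w f has to be asserted separately. *)
Fixpoint dword_exists (R : realType) (n : nat) (w : seq 'I_n)
    (f : 'rV[R]_n -> R) : Prop :=
  match w with
  | [::] => True
  | i :: w' => dword_exists w' f /\
               forall x, derivable (dword w' f) x (delta_mx 0 i)
  end.

Definition Cr (R : realType) (n r : nat) (f : 'rV[R]_n -> R) : Prop :=
  forall w : seq 'I_n, (size w <= r)%N ->
    dword_exists w f /\ continuous (dword w f).

Definition mdegree (n : nat) (alpha : 'I_n -> nat) : nat :=
  (\sum_(i < n) alpha i)%N.

(* d^|alpha| / d x_1^alpha_1 .. d x_n^alpha_n, composed in this order: the
   derivatives in x_n are taken first. *)
Definition mword (n : nat) (alpha : 'I_n -> nat) : seq 'I_n :=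
  flatten [seq nseq (alpha i) i | i <- enum 'I_n].

Definition mderiv (R : realType) (n : nat) (alpha : 'I_n -> nat)
    (f : 'rV[R]_n -> R) : 'rV[R]_n -> R :=
  dword (mword alpha) f.

Definition mderiv_exists (R : realType) (n : nat) (alpha : 'I_n -> nat)
    (f : 'rV[R]_n -> R) : Prop :=
  dword_exists (mword alpha) f.

(* The point x of R^d with x_j = t and x_{-j} = y: the k-th component of y is
   the component lift j k of x. *)
Definition insert_coord (R : realType) (d : nat) (j : 'I_d) (t : R)
    (y : 'rV[R]_d.-1) : 'rV[R]_d :=
  \row_i (if unlift j i is Some k then y 0 k else t).

Definition preint_integrand (R : realType) (d : nat) (j : 'I_d)
    (f : 'rV[R]_d -> R) (y : 'rV[R]_d.-1) : R -> R :=
  fun t => f (insert_coord j t y) * normal_pdf 0 1 t.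

Definition preint (R : realType) (d : nat) (j : 'I_d) (f : 'rV[R]_d -> R) :
    'rV[R]_d.-1 -> R :=
  fun y => \int[lebesgue_measure]_t preint_integrand j f y t.

(* Main.v *)
Require Import Defs.
From HB Require Import structures.
From mathcomp Require Import all_boot all_order all_algebra.
From mathcomp Require Import all_classical all_reals all_analysis.
From mathcomp Require Import measurable_realfun.
From mathcomp Require Import ring lra.

Set Implicit Arguments.
Unset Strict Implicit.
Unset Printing Implicit Defensive.

Import Order.TTheory GRing.Theory Num.Theory.
Import numFieldNormedType.Exports.

Local Open Scope classical_set_scope.
Local Open Scope ring_scope.

(** The function to differentiate is the integral of [g * rho] over the part of a
    line where [phi >= 0], [rho] being the normal density. As [phi] is strictly
    monotone in the coordinate [j], of direction [sg = 1] or [sg = -1], every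
    line over [y] contains at most one zero [xi] of [phi]. Let [D_k] denote the
    derivative along another coordinate. Where the zero exists, it depends on [y]
    with derivative [- D_k phi / D_j phi], so that

      D_k (int g) = int (D_k g) + S (sg * g * D_k phi / D_j phi),
      D_k (S h)   = S (D_k h - D_k phi / D_j phi * (D_j h - x_j * h)),

    where [S h] is the value of [h * rho] at the zero ([half_integral_partial],
    [boundary_term_partial]). Iterating these two formulas writes any derivative
    of order at most [r] as an integral of a derivative of [g] plus a boundary
    term [S h] ([dword_half_integral]). Each derivation lowers by one the
    smoothness of [h], which is built from [g], [phi], [1 / D_j phi] and [x_j]
    by sums, products and derivations. The class [Cexpo] of functions with
    exponentially bounded derivatives is closed under these operations, and
    multiplication by [rho] turns exponential growth in the coordinate [j] into a
    constant, whence the bounds in [y].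

    The delicate points are those [y] whose line contains no zero, where [S h]
    is set to [0]: the zero may escape to infinity when [y] is approached. Let
    the sign of [phi] at height [t] change between [y] and a point at distance
    [s]. Then [|phi (t, y)|] is at most [|s|] times an exponential in [|t|],
    while it is at least an inverse exponential in [|t|], since otherwise the
    slope of [phi] would force a zero at distance at most 1 from [t]. Hence
    [1 <= C * |s| * expR (c * |t|)] ([far_sign_change]). The square of this
    estimate, together with the decay of [rho], makes [S h] and the change of the
    integral due to the moving indicator [O(s ^ 2)], so that they contribute a
    zero derivative.

    The hypotheses bound the derivatives in one fixed order only; Schwarz's
    theorem ([partial_comm], [dword_perm]) gives them in every order. *)

(** * Calculus in two variables near a parameter value *)

Lemma near0_lt (R : realType) (e : R) : 0 < e -> \forall x \near (0 : R), `|x| < e.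
Proof. by move=> e0; exact: (@nbhs0_lt R R). Qed.

(** The mean value theorem for end points in either order. *)
Lemma mean_value (R : realType) (f df : R -> R) (a b : R) :
  (forall x : R, is_derive x 1 f (df x)) ->
  exists c, `|c - a| <= `|b - a| /\ f b - f a = df c * (b - a).
Proof.
move=> fdf.
have cf (u v : R) : {within `[u, v], continuous f}.
  by apply: derivable_within_continuous => x _; have [] := fdf x.
have [ab|ba] := leP a b.
  have [c + ->] := @MVT_segment R f df a b ab (fun x _ => fdf x) (cf a b).
  rewrite in_itv/= => /andP[ac cb]; exists c; split => //.
  by rewrite !ger0_norm ?subr_ge0// lerB.
have [c + e] := @MVT_segment R f df b a (ltW ba) (fun x _ => fdf x) (cf b a).
rewrite in_itv/= => /andP[bc ca]; exists c; split.
  by rewrite distrC (distrC b) !ger0_norm ?subr_ge0 ?(ltW ba)// lerB.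
by rewrite -opprB e -mulrN opprB.
Qed.

(** Joint continuity at the point [(t0, 0)], in epsilon-delta form. *)
Definition jcont (R : realType) (q : R -> R -> R) (t0 : R) : Prop :=
  forall e, 0 < e -> exists2 dl, 0 < dl &
    forall t s, `|t - t0| < dl -> `|s| < dl -> `|q t s - q t0 0| < e.

Lemma jcont_cvg (R : realType) (q : R -> R -> R) (t0 : R) (u v : R -> R) :
  jcont q t0 -> u x @[x --> 0] --> t0 -> v x @[x --> 0] --> 0 ->
  q (u x) (v x) @[x --> 0] --> q t0 0.
Proof.
move=> qc ut v0; apply/cvgrPdist_lt => e e0.
have [dl dl0 qd] := qc _ e0.
near=> x; rewrite distrC; apply: qd.
  by near: x; exact: cvgr_distC_lt ut _ dl0.
rewrite -[v x]subr0; near: x; exact: cvgr_distC_lt v0 _ dl0.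
Unshelve. all: by end_near.
Qed.

Lemma jcontP (R : realType) (q : R -> R -> R) (t0 : R) :
  jcont q t0 <-> {for (t0, 0), continuous (fun z : R * R => q z.1 z.2)}.
Proof.
split=> [qc|/cvgrPdist_lt qc e e0].
  apply/cvgrPdist_lt => e e0; have [dl dl0 qd] := qc _ e0.
  exists (ball t0 dl, ball 0 dl) => /=; first by split; exact: nbhsx_ballx.
  move=> [t s] [/= bt bs]; rewrite distrC; apply: qd; first by rewrite distrC.
  by move: bs; rewrite /ball/= sub0r normrN.
have [[A B] /= [/nbhs_ballP[a a0 aA] /nbhs_ballP[b b0 bB]] AB] := qc _ e0.
exists (Num.min a b); first by rewrite lt_min a0.
move=> t s; rewrite !lt_min => /andP[ta _] /andP[_ sb].
rewrite distrC; apply: (AB (t, s)); split => /=.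
  by apply: aA; rewrite /ball/= distrC.
by apply: bB; rewrite /ball/= sub0r normrN.
Qed.

Lemma jcontM (R : realType) (q1 q2 : R -> R -> R) (t0 : R) :
  jcont q1 t0 -> jcont q2 t0 -> jcont (fun t s => q1 t s * q2 t s) t0.
Proof. by move=> /jcontP h1 /jcontP h2; apply/jcontP; exact: cvgM. Qed.

Lemma jcontD (R : realType) (q1 q2 : R -> R -> R) (t0 : R) :
  jcont q1 t0 -> jcont q2 t0 -> jcont (fun t s => q1 t s + q2 t s) t0.
Proof. by move=> /jcontP h1 /jcontP h2; apply/jcontP; exact: cvgD. Qed.

Lemma jcont_fst (R : realType) (f : R -> R) (t0 : R) :
  {for t0, continuous f} -> jcont (fun t _ => f t) t0.
Proof.
move=> fc; apply/jcontP => /=; apply: continuous_comp => //=; exact: cvg_fst.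
Qed.

(** First order expansion along a curve [s |-> (u s, s)], with coefficients
    tending to the partial derivatives. *)
Lemma increment (R : realType) (q qt qs : R -> R -> R) (t0 : R) (u : R -> R) :
  (forall t s : R, is_derive t 1 (q^~ s) (qt t s)) ->
  (forall t s : R, is_derive s 1 (q t) (qs t s)) ->
  jcont qt t0 -> jcont qs t0 -> u x @[x --> 0] --> t0 ->
  exists a b : R -> R,
   [/\ a x @[x --> 0] --> qt t0 0, b x @[x --> 0] --> qs t0 0 &
     forall s, q (u s) s - q t0 0 = a s * (u s - t0) + b s * s].
Proof.
move=> dqt dqs ct cs ut.
have /choice[al al_] : forall s, exists c,
    `|c - t0| <= `|u s - t0| /\ q (u s) s - q t0 s = qt c s * (u s - t0).
  by move=> s; apply: (@mean_value R (q^~ s)).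
have /choice[be be_] : forall s, exists c,
    `|c - 0| <= `|s - 0| /\ q t0 s - q t0 0 = qs t0 c * (s - 0).
  by move=> s; apply: (@mean_value R (q t0)).
exists (fun s => qt (al s) s), (fun s => qs t0 (be s)); split.
- apply: jcont_cvg => //; apply/cvgrPdist_lt => e e0.
  near=> x; rewrite distrC (le_lt_trans (al_ x).1)//.
  by near: x; exact: cvgr_distC_lt ut _ e0.
- apply: (@jcont_cvg R qs t0 (cst t0) be) => //; first exact: cvg_cst.
  apply/cvgrPdist_lt => e e0; near=> x.
  have x_e : `|x| < e by near: x; exact: near0_lt.
  by rewrite distrC (le_lt_trans (be_ x).1)// subr0.
- move=> s; rewrite -(subrKA (q t0 s)) (al_ s).2.
  by rewrite (be_ s).2 subr0.
Unshelve. all: by end_near. Qed.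

(** Here, as wherever [sg] occurs, [p] is strictly monotone in its first variable
    and its slope has the sign of [sg]. *)
Lemma sign_change (R : realType) (p pt : R -> R -> R) (sg x t s : R) :
  (forall t s : R, is_derive t 1 (p^~ s) (pt t s)) ->
  (forall t s, 0 < sg * pt t s) -> p x s = 0 -> t != x ->
  0 < sg * p t s * (t - x).
Proof.
move=> dp pp px tx.
have [c [_]] := @mean_value R (p^~ s) (pt^~ s) x t (fun t => dp t s).
rewrite px subr0 => ->; rewrite mulrA -mulrA -expr2 mulr_gt0//.
by rewrite exprn_even_gt0//= subr_eq0.
Qed.

Lemma zero_unique (R : realType) (p pt : R -> R -> R) (sg x t s : R) :
  (forall t s : R, is_derive t 1 (p^~ s) (pt t s)) ->
  (forall t s, 0 < sg * pt t s) -> p x s = 0 -> p t s = 0 -> t = x.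
Proof.
move=> dp pp px pts; apply/eqP; apply: contraT => tx.
have := @sign_change R p pt sg x t s dp pp px tx.
by rewrite pts mulr0 mul0r ltxx.
Qed.

Lemma zero_between (R : realType) (p pt : R -> R -> R) (sg a b s : R) :
  (forall t s : R, is_derive t 1 (p^~ s) (pt t s)) ->
  a <= b -> sg * p a s < 0 -> 0 < sg * p b s ->
  exists2 x, a < x < b & p x s = 0.
Proof.
move=> dp ab pa pb.
have cf : {within `[a, b], continuous (fun t => sg * p t s)}.
  apply: derivable_within_continuous => x _.
  by have := dp x s; move=> /(is_deriveZ sg) [].
have := @IVT R (fun t => sg * p t s) a b 0 ab cf.
rewrite minEle maxEle (ltW (lt_trans pa pb)) (ltW pa) (ltW pb) => /(_ isT).
move=> [c]; rewrite in_itv/= => /andP[ac cb] /eqP.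
rewrite mulf_eq0 => /orP[/eqP s0|].
  by move: pa; rewrite s0 mul0r ltxx.
move=> /eqP pc; exists c => //; rewrite !lt_neqAle ac cb !andbT.
apply/andP; split; apply/eqP => e.
  by move: pa; rewrite e pc mulr0 ltxx.
by move: pb; rewrite -e pc mulr0 ltxx.
Qed.

(** Implicit function theorem in two variables, for a function that is strictly
    monotone in its first variable [t]: a zero persists under small changes of
    the second variable, and stays close. *)
Lemma zero_persists (R : realType) (p pt : R -> R -> R) (sg t0 e : R) :
  (forall t s : R, is_derive t 1 (p^~ s) (pt t s)) ->
  (forall t s, 0 < sg * pt t s) -> (forall t, jcont p t) ->
  p t0 0 = 0 -> 0 < e ->
  \forall s \near 0, exists2 x, `|x - t0| < e & p x s = 0.
Proof.
move=> dp pp cp p0 e0.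
have sg0 : 0 < `|sg|.
  rewrite normr_gt0; apply/eqP => s0; have := pp 0 0.
  by rewrite s0 mul0r ltxx.
have a0 : sg * p (t0 - e) 0 < 0.
  have := @sign_change R p pt sg t0 (t0 - e) 0 dp pp p0.
  by rewrite -subr_eq0 addrAC subrr sub0r oppr_eq0 gt_eqF// => /(_ isT); nra.
have b0 : 0 < sg * p (t0 + e) 0.
  have := @sign_change R p pt sg t0 (t0 + e) 0 dp pp p0.
  by rewrite -subr_eq0 addrAC subrr add0r gt_eqF// => /(_ isT); nra.
(* The strict signs at [t0 - e] and [t0 + e] persist for nearby parameters. *)
have near_sign t : sg * p t 0 != 0 ->
    \forall s \near 0, `|sg * p t s - sg * p t 0| < `|sg * p t 0|.
  move=> nz; have [|dl dl0 H] := cp t (`|sg * p t 0| / `|sg|).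
    by rewrite divr_gt0// normr_gt0.
  near=> s; rewrite -mulrBr normrM mulrC -ltr_pdivlMr//.
  by apply: H; rewrite ?subrr ?normr0//; near: s; apply: near0_lt.
have [na nb] := (near_sign _ (ltr0_neq0 a0), near_sign _ (lt0r_neq0 b0)).
near=> s.
have sa : sg * p (t0 - e) s < 0.
  have : `|sg * p (t0 - e) s - sg * p (t0 - e) 0| < `|sg * p (t0 - e) 0|.
    by near: s.
  by rewrite (ltr0_norm a0) ltr_norml => /andP[]; lra.
have sb : 0 < sg * p (t0 + e) s.
  have : `|sg * p (t0 + e) s - sg * p (t0 + e) 0| < `|sg * p (t0 + e) 0|.
    by near: s.
  by rewrite (gtr0_norm b0) ltr_norml => /andP[]; lra.
have [|x /andP[x1 x2] px] := @zero_between R p pt sg (t0 - e) (t0 + e) s dp _ sa sb.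
  by lra.
by exists x => //; rewrite ltr_norml; apply/andP; split; lra.
Unshelve. all: by end_near. Qed.

Lemma zero_curve_cvg (R : realType) (p pt : R -> R -> R) (sg t0 : R) (z : R -> R) :
  (forall t s : R, is_derive t 1 (p^~ s) (pt t s)) ->
  (forall t s, 0 < sg * pt t s) -> (forall t, jcont p t) ->
  p t0 0 = 0 ->
  (forall s, (exists t, p t s = 0) -> p (z s) s = 0) ->
  z s @[s --> 0] --> t0.
Proof.
move=> dp pp cp p0 hz; apply/cvgrPdist_lt => e e0.
have := @zero_persists R p pt sg t0 e dp pp cp p0 e0.
apply: filterS => s [x xe px].
have -> : z s = x.
  by apply: (@zero_unique R p pt sg _ _ s) => //; apply: hz; exists x.
by rewrite distrC.
Qed.

(** The function [z] need only select a zero where there is one; its values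
    elsewhere are irrelevant. *)
Lemma zero_curve_derivative (R : realType) (p pt ps : R -> R -> R) (sg t0 : R)
    (z : R -> R) :
  (forall t s : R, is_derive t 1 (p^~ s) (pt t s)) ->
  (forall t s : R, is_derive s 1 (p t) (ps t s)) ->
  (forall t s, 0 < sg * pt t s) -> (forall t, jcont p t) ->
  (forall t, jcont pt t) -> (forall t, jcont ps t) ->
  p t0 0 = 0 ->
  (forall s, (exists t, p t s = 0) -> p (z s) s = 0) ->
  (z s - t0) / s @[s --> 0^'] --> - (ps t0 0 / pt t0 0).
Proof.
move=> dp dps pp cp cpt cps p0 hz.
have zc := @zero_curve_cvg R p pt sg t0 z dp pp cp p0 hz.
have [a [b [ac bc ab]]] := @increment R p pt ps t0 z dp dps (cpt t0) (cps t0) zc.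
have nz : pt t0 0 != 0.
  by apply/eqP => e; have := pp t0 0; rewrite e mulr0 ltxx.
have ex := @zero_persists R p pt sg t0 1 dp pp cp p0 ltr01.
apply: (@cvg_trans _ (- (b s / a s) @[s --> 0^'])); last first.
  by apply: cvgN; apply: cvgM; [|apply: cvgV => //]; apply: cvg_within_filter.
apply: near_eq_cvg.
have anz : \forall s \near 0^', a s != 0.
  apply: cvg_within.
  have := @cvgr_neq0 _ _ _ _ _ a _ ac nz; exact.
have ex' : \forall s \near 0^', exists2 x, `|x - t0| < 1 & p x s = 0.
  exact: cvg_within.
near=> s.
have as0 : a s != 0 by near: s.
have s0 : s != 0 by near: s; exact: nbhs_dnbhs_neq.
have [x _ px] : exists2 x, `|x - t0| < 1 & p x s = 0 by near: s.
have := ab s; rewrite hz; last by exists x.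
rewrite p0 subrr => /esym/eqP; rewrite addr_eq0 => /eqP e.
apply/eqP; rewrite -mulNr eqr_div//; apply/eqP.
by rewrite mulNr -e mulrC.
Unshelve. all: by end_near. Qed.

(** Derivative of [s |-> q (z s) s] along the curve of zeros [z] of [p]. *)
Lemma along_zero_curve (R : realType) (p pt ps q qt qs : R -> R -> R)
    (sg t0 : R) (z : R -> R) :
  (forall t s : R, is_derive t 1 (p^~ s) (pt t s)) ->
  (forall t s : R, is_derive s 1 (p t) (ps t s)) ->
  (forall t s, 0 < sg * pt t s) -> (forall t, jcont p t) ->
  (forall t, jcont pt t) -> (forall t, jcont ps t) ->
  (forall t s : R, is_derive t 1 (q^~ s) (qt t s)) ->
  (forall t s : R, is_derive s 1 (q t) (qs t s)) ->
  jcont qt t0 -> jcont qs t0 ->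
  p t0 0 = 0 ->
  (forall s, (exists t, p t s = 0) -> p (z s) s = 0) ->
  (q (z s) s - q t0 0) / s @[s --> 0^'] -->
    qs t0 0 - ps t0 0 / pt t0 0 * qt t0 0.
Proof.
move=> dp dps pp cp cpt cps dq dqs cqt cqs p0 hz.
have zc := @zero_curve_cvg R p pt sg t0 z dp pp cp p0 hz.
have zd := @zero_curve_derivative R p pt ps sg t0 z dp dps pp cp cpt cps p0 hz.
have [a [b [ac bc ab]]] := @increment R q qt qs t0 z dq dqs cqt cqs zc.
have -> : qs t0 0 - ps t0 0 / pt t0 0 * qt t0 0 =
  qt t0 0 * - (ps t0 0 / pt t0 0) + qs t0 0 by ring.
apply: (@cvg_trans _ (a s * ((z s - t0) / s) + b s @[s --> 0^'])); last first.
  by apply: cvgD; [apply: cvgM => //|]; apply: cvg_within_filter.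
apply: near_eq_cvg; near=> s.
have s0 : s != 0 by near: s; exact: nbhs_dnbhs_neq.
by rewrite ab [RHS]mulrDl mulfK// mulrA.
Unshelve. all: by end_near. Qed.

(** When [p t 0] does not vanish for any [t], a change of sign of [p] between
    parameters [0] and [s] can only happen far away, at distance at least
    of order [- ln |s|]. *)
Lemma far_sign_change (R : realType) (p pt ps : R -> R -> R) (sg M : R) :
  (forall t s : R, is_derive t 1 (p^~ s) (pt t s)) ->
  (forall t s : R, is_derive s 1 (p t) (ps t s)) ->
  (forall t s, 0 < sg * pt t s) -> 0 <= M ->
  (forall t s, `|s| <= 1 -> `|ps t s| <= M * expR (M * `|t|)) ->
  (forall t s, `|s| <= 1 -> `|pt t s|^-1 <= M * expR (M * `|t|)) ->
  (forall t, p t 0 != 0) ->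
  forall t s, `|s| <= 1 -> p t 0 * p t s <= 0 ->
    1 <= M ^+ 2 * expR M * (`|s| * expR ((M + M) * `|t|)).
Proof.
move=> dp dps pp M0 psb ptb pnz t s s1 pts.
(* As the sign changes, [|p t 0|] is at most [|p t s - p t 0|]. *)
have up : `|p t 0| <= `|s| * (M * expR (M * `|t|)).
  have [c [c1 c2]] := @mean_value R (p t) (ps t) 0 s (dps t).
  rewrite !subr0 in c1 c2.
  have le1 : `|p t 0| <= `|p t s - p t 0|.
    rewrite -(@ler_pXn2r _ 2)// ?nnegrE// !real_normK ?num_real//.
    by rewrite sqrrB; nra.
  by rewrite (le_trans le1)// c2 normrM mulrC ler_wpM2l// psb// (le_trans c1).
have expt (c : R) : `|c - t| <= 1 -> `|pt c 0|^-1 <= M * (expR M * expR (M * `|t|)).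
  move=> ct; rewrite (le_trans (ptb c 0 _)) ?normr0// ler_wpM2l// -expRD ler_expR.
  rewrite -{2}[M]mulr1 -mulrDr ler_wpM2l// -(subrK t c).
  by rewrite (le_trans (ler_normD _ _))// lerD2r.
have ptnz c : 0 < `|pt c 0|.
  rewrite normr_gt0; apply/eqP => e; have := pp c 0.
  by rewrite e mulr0 ltxx.
have sg0 : 0 < `|sg|.
  by rewrite normr_gt0; apply/eqP => e; have := pp 0 0; rewrite e mul0r ltxx.
(* A value smaller than the slopes within distance 1 would force a zero there. *)
have dn : exists2 c, `|c - t| <= 1 & `|pt c 0| <= `|p t 0|.
  have [pos|neg] := ltP 0 (sg * p t 0).
    have [c [c1 c2]] := @mean_value R (p^~ 0) (pt^~ 0) t (t - 1) (fun t => dp t 0).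
    have e1 : t - 1 - t = -1 by ring.
    rewrite e1 normrN1 in c1; rewrite e1 mulrN1 in c2; exists c => //.
    have [neg|pos'] := ltP (sg * p (t - 1) 0) 0.
      have [|x _ px] := @zero_between R p pt sg (t - 1) t 0 dp _ neg pos.
        by lra.
      by have := pnz x; rewrite px eqxx.
    have e2 : sg * pt c 0 <= sg * p t 0 by nra.
    rewrite -(@ler_pM2l _ `|sg|) ?sg0// -!normrM !gtr0_norm//.
  have neg' : sg * p t 0 < 0.
    rewrite lt_neqAle neg andbT mulf_neq0//.
    by apply/eqP => e; have := pp 0 0; rewrite e mul0r ltxx.
  have [c [c1 c2]] := @mean_value R (p^~ 0) (pt^~ 0) t (t + 1) (fun t => dp t 0).
  have e1 : t + 1 - t = 1 by ring.
  rewrite e1 normr1 in c1; rewrite e1 mulr1 in c2; exists c => //.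
  have [pos|neg1] := ltP 0 (sg * p (t + 1) 0).
    have [|x _ px] := @zero_between R p pt sg t (t + 1) 0 dp _ neg' pos.
      by lra.
    by have := pnz x; rewrite px eqxx.
  have e2 : sg * pt c 0 <= - (sg * p t 0) by nra.
  rewrite -(@ler_pM2l _ `|sg|) ?sg0//.
  by rewrite -!normrM (gtr0_norm (pp c 0)) (ltr0_norm neg').
have [c c1 c2] := dn.
have c3 := expt _ c1.
have e1 : 1 <= `|p t 0| * `|pt c 0|^-1 by rewrite ler_pdivlMr// mul1r.
rewrite (le_trans e1)// (le_trans (ler_pM _ _ up c3))// ?invr_ge0//.
rewrite mulrDl expRD le_eqVlt; apply/orP; left; apply/eqP; ring.
Qed.

(** * Integrals against the normal density *)

Lemma derive_normal_pdf (R : realType) (t : R) :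
  is_derive t 1 (@normal_pdf R 0 1) (- t * normal_pdf 0 1 t).
Proof.
have pE : @normal_pdf R 0 1 =
    (normal_peak 1 : R) \*: (expR \o ((- 2^-1 : R) \*: (fun x : R => x ^+ 2))).
  rewrite normal_pdfE ?oner_neq0//; apply/funext => x.
  rewrite /normal_fun /= subr0 expr1n; congr (_ * expR _).
  by rewrite mulNr [in RHS]/GRing.scale/= mulNr mulrC.
rewrite {1}pE.
apply: is_derive_eq.
by rewrite pE /= /GRing.scale/= -mulr_natl; field.
Qed.

(** Exponential factors are absorbed by passing from variance 1 to variance 4. *)
Lemma expo_normal_pdf_le (R : realType) (c : R) : 0 <= c ->
  exists2 C : R, 0 <= C & forall t,
    expR (c * `|t|) * normal_pdf 0 1 t <= C * normal_pdf 0 2 t.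
Proof.
move=> c0.
exists (expR (2 * c ^+ 2) * (normal_peak 1 / normal_peak 2)).
  by rewrite mulr_ge0 ?expR_ge0// divr_ge0// normal_peak_ge0.
move=> t; rewrite !normal_pdfE ?oner_neq0 ?pnatr_eq0//.
rewrite /normal_fun subr0 expr1n.
have p0 : 0 < normal_peak (2 : R) by rewrite normal_peak_gt0// pnatr_eq0.
rewrite -[leRHS]mulrA (mulrA (_ / _)) divfK ?gt_eqF//.
rewrite !(mulrCA _ (normal_peak 1)) ler_wpM2l ?normal_peak_ge0//.
rewrite -!expRD ler_expR.
have -> : (2 : R) ^+ 2 *+ 2 = 8 by rewrite -mulr_natl; ring.
rewrite -(real_normK (num_real t)).
have := sqr_ge0 (c - `|t| / 4); have := sqr_ge0 `|t|; nra.
Qed.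

Lemma expo_normal_pdf_bounded (R : realType) (c : R) : 0 <= c ->
  exists2 C : R, 0 <= C & forall t, expR (c * `|t|) * normal_pdf 0 1 t <= C.
Proof.
move=> c0; have [C C0 CP] := expo_normal_pdf_le c0.
exists (C * normal_peak 2); first by rewrite mulr_ge0// normal_peak_ge0.
move=> t; rewrite (le_trans (CP t))// ler_wpM2l//.
by rewrite normal_pdf_ub// pnatr_eq0.
Qed.

Lemma measurable_expo_abs (R : realType) (c : R) :
  measurable_fun [set: R] (fun t : R => expR (c * `|t|)).
Proof.
by apply: measurableT_comp => //; apply: measurable_funM.
Qed.

Lemma integrable_expo_normal_pdf (R : realType) (c : R) : 0 <= c ->
  (@lebesgue_measure R).-integrable setT
    (EFin \o (fun t : R => expR (c * `|t|) * normal_pdf 0 1 t)).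
Proof.
move=> c0; have [C C0 CP] := expo_normal_pdf_le c0.
have := integrableZl measurableT C (@integrable_normal_pdf R 0 2).
apply: le_integrable => //.
  apply/measurable_EFinP; apply: measurable_funM; first exact: measurable_expo_abs.
  exact: measurable_normal_pdf.
move=> t _ /=; rewrite lee_fin ger0_norm ?mulr_ge0 ?expR_ge0 ?normal_pdf_ge0//.
by rewrite [leRHS]ger0_norm ?mulr_ge0 ?normal_pdf_ge0//; exact: CP.
Qed.

(** The expectation of [expR (c * |T|)] for a standard normal variable [T]. *)
Definition expo_moment (R : realType) (c : R) : R :=
  \int[lebesgue_measure]_t (expR (c * `|t|) * normal_pdf 0 1 t).

Lemma integrable_normal_weight (R : realType) (u : R -> R) (C c : R) :
  0 <= c -> measurable_fun setT u -> (forall t, `|u t| <= C * expR (c * `|t|)) ->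
  (@lebesgue_measure R).-integrable setT
    (EFin \o (fun t : R => u t * normal_pdf 0 1 t)).
Proof.
move=> c0 mu ub.
have := integrableZl measurableT C (integrable_expo_normal_pdf c0).
apply: le_integrable => //.
  apply/measurable_EFinP; apply: measurable_funM => //.
  exact: measurable_normal_pdf.
move=> t _ /=; rewrite lee_fin !normrM (ger0_norm (normal_pdf_ge0 _ _ _)).
rewrite [in leRHS]mulrA ler_wpM2r ?normal_pdf_ge0//.
rewrite (le_trans (ub t))// (ger0_norm (expR_ge0 _)).
by rewrite ler_wpM2r ?expR_ge0// ler_norm.
Qed.

Lemma integral_normal_weight_le (R : realType) (u : R -> R) (C c : R) :
  0 <= c -> measurable_fun setT u -> (forall t, `|u t| <= C * expR (c * `|t|)) ->
  `|\int[lebesgue_measure]_t (u t * normal_pdf 0 1 t)| <= C * expo_moment c.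
Proof.
move=> c0 mu ub.
have iu := integrable_normal_weight c0 mu ub.
rewrite (le_trans (le_normr_Rintegral _ iu))//.
rewrite /expo_moment -RintegralZl//; last exact: integrable_expo_normal_pdf.
apply: le_Rintegral => //.
- exact: (integrable_norm iu).
- exact: (integrableZl measurableT C (integrable_expo_normal_pdf c0)).
- move=> t _; rewrite normrM (ger0_norm (normal_pdf_ge0 _ _ _)) mulrA.
  by rewrite ler_wpM2r ?normal_pdf_ge0.
Qed.

Lemma derivative_measurable (R : realType) (f df : R -> R) :
  (forall t : R, is_derive t 1 f (df t)) -> measurable_fun setT f.
Proof.
move=> fdf; apply: continuous_measurable_fun => t.
by apply: differentiable_continuous; apply/derivable1_diffP; have [] := fdf t.
Qed.

Lemma measurable_nonneg (R : realType) (p : R -> R) :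
  measurable_fun setT p -> measurable_fun setT (fun t => (0 <= p t)%R%:R : R).
Proof.
move=> mp; have -> : (fun t => (0 <= p t)%R%:R : R) = \1_(p @^-1` `[0, +oo[).
  apply/funext => t; rewrite indicE; congr (nat_of_bool _)%:R.
  by apply/idP/idP; rewrite inE/= in_itv/= andbT.
apply: measurable_indic.
by rewrite -[X in measurable X]setTI; apply: mp.
Qed.

(** A continuously differentiable function of two variables that is, together
    with its partial derivatives, at most exponential in the first variable
    uniformly over the parameters in [[-1, 1]]. *)
Record C1_expo (R : realType) (q qt qs : R -> R -> R) (M : R) : Prop := {
  C1_dt : forall t s : R, is_derive t 1 (q^~ s) (qt t s);
  C1_ds : forall t s : R, is_derive s 1 (q t) (qs t s);
  C1_cont : forall t, jcont q t;
  C1_cont_dt : forall t, jcont qt t;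
  C1_cont_ds : forall t, jcont qs t;
  C1_le : forall t s, `|s| <= 1 -> `|q t s| <= M * expR (M * `|t|);
  C1_dt_le : forall t s, `|s| <= 1 -> `|qt t s| <= M * expR (M * `|t|);
  C1_ds_le : forall t s, `|s| <= 1 -> `|qs t s| <= M * expR (M * `|t|) }.

Lemma C1_expo_ge0 (R : realType) (q qt qs : R -> R -> R) (M : R) :
  C1_expo q qt qs M -> 0 <= M.
Proof.
case=> _ _ _ _ _ /(_ 0 0); rewrite !normr0 mulr0 expR0 mulr1 ler01 => /(_ isT).
by move=> H _ _; exact: le_trans H.
Qed.

(** Differentiation under the integral sign, with a fixed weight [chi]. *)
Lemma weighted_integral_derivative (R : realType) (k kt ks : R -> R -> R)
    (chi : R -> R) (M : R) :
  C1_expo k kt ks M -> measurable_fun setT chi -> (forall t, `|chi t| <= 1) ->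
  (\int[lebesgue_measure]_t (k t s * chi t * normal_pdf 0 1 t) -
   \int[lebesgue_measure]_t (k t 0 * chi t * normal_pdf 0 1 t)) / s
  @[s --> 0^'] --> \int[lebesgue_measure]_t (ks t 0 * chi t * normal_pdf 0 1 t).
Proof.
move=> kC mchi chi1; have M0 := C1_expo_ge0 kC.
pose f s t := k t s * chi t * normal_pdf 0 1 t.
have mk s : measurable_fun setT (k^~ s).
  exact: (@derivative_measurable R _ (kt^~ s) (fun t => C1_dt kC t s)).
have bd (a t : R) : `|a| <= M * expR (M * `|t|) ->
    `|a * chi t| <= M * expR (M * `|t|).
  by move=> aM; rewrite normrM -[leRHS]mulr1 ler_pM.
have df (s t : R) : is_derive s 1 (f^~ t) (ks t s * chi t * normal_pdf 0 1 t).
  have H : is_derive s 1 ((chi t * normal_pdf 0 1 t) \*: k t)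
      ((chi t * normal_pdf 0 1 t) *: ks t s).
    by apply: is_deriveZ; exact: C1_ds kC t s.
  have -> : f^~ t = (chi t * normal_pdf 0 1 t) \*: k t.
    by apply/funext => x; rewrite /f /= /GRing.scale/=; ring.
  by apply: is_derive_eq; rewrite /GRing.scale/=; ring.
have d1 s t : partial1of2 f s t = ks t s * chi t * normal_pdf 0 1 t.
  by rewrite partial1of2E; have := df s t => -[].
have I0 (s : R) : `]-1, 1[%classic s -> `|s| <= 1.
  by rewrite /= in_itv/= => /andP[s1 s2]; rewrite ler_norml !ltW.
have I1 : `]-1, 1[%classic (0 : R) by rewrite /= in_itv/= ltrN10 ltr01.
have fi (s : R) : `]-1, 1[%classic s ->
    (@lebesgue_measure R).-integrable setT (EFin \o f s).
  move=> /I0 s1; apply: (@integrable_normal_weight R _ M M) => //.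
    exact: measurable_funM.
  by move=> t; apply: bd; exact: C1_le kC _ _ s1.
have fd (s t : R) : `]-1, 1[%classic s -> setT t -> derivable (f^~ t) s 1.
  by move=> _ _; have [] := df s t.
have G0 (t : R) : 0 <= M * (expR (M * `|t|) * normal_pdf 0 1 t).
  by rewrite !mulr_ge0 ?expR_ge0 ?normal_pdf_ge0.
have Gi := integrableZl measurableT M (integrable_expo_normal_pdf M0).
have Gub (s t : R) : `]-1, 1[%classic s -> setT t ->
    `|partial1of2 f s t| <= M * (expR (M * `|t|) * normal_pdf 0 1 t).
  move=> /I0 s1 _; rewrite d1 normrM (ger0_norm (normal_pdf_ge0 _ _ _)) mulrA.
  by rewrite ler_wpM2r ?normal_pdf_ge0// bd// (C1_ds_le kC).
have := @cvg_differentiation_under_integral R _ _ lebesgue_measure f setT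
  measurableT 0 (-1) 1 I1 fi fd _ G0 Gi Gub.
rewrite (@eq_Rintegral _ _ _ lebesgue_measure setT
  (fun t => ks t 0 * chi t * normal_pdf 0 1 t) (partial1of2 f 0)); last first.
  by move=> t _; rewrite d1.
apply: cvg_trans.
rewrite [X in _ --> X @ _](_ : _ = fun s : R =>
  (\int[lebesgue_measure]_t (k t s * chi t * normal_pdf 0 1 t) -
   \int[lebesgue_measure]_t (k t 0 * chi t * normal_pdf 0 1 t)) / s)//.
by apply/funext => s; rewrite addr0 /GRing.scale/= mulrC.
Qed.

Lemma quadratic_quotient_cvg0 (R : realType) (f : R -> R) (C : R) :
  (forall s, `|s| <= 1 -> `|f s| <= C * s ^+ 2) -> f s / s @[s --> 0^'] --> 0.
Proof.
move=> fC.
have C0 : 0 <= C.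
  by have := fC 1; rewrite normr1 expr1n mulr1 lexx => /(_ isT); exact: le_trans.
apply/cvgr0Pnorm_lt => e e0.
have d0 : 0 < Num.min 1 (e / (C + 1)) by rewrite lt_min ltr01 divr_gt0// ltr_wpDl.
have nd : \forall s \near (0:R)^', `|s| < Num.min 1 (e / (C + 1)).
  by apply: cvg_within; exact: near0_lt.
near=> s.
have s0 : s != 0 by near: s; exact: nbhs_dnbhs_neq.
have : `|s| < Num.min 1 (e / (C + 1)) by near: s.
rewrite lt_min => /andP[s1 se].
rewrite normrM normfV ltr_pdivrMr ?normr_gt0//.
rewrite (le_lt_trans (fC _ (ltW s1)))// -(real_normK (num_real s)) expr2 mulrA.
rewrite ltr_pM2r ?normr_gt0//.
move: se; rewrite ltr_pdivlMr ?ltr_wpDl// => se.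
by rewrite (le_lt_trans _ se)// mulrC ler_wpM2l// lerDl.
Unshelve. all: by end_near. Qed.

(** The integral of [k] over an interval of length [l] is [k0 * l] up to [e * l]
    if [k] is within [e] of [k0] there. *)
Lemma interval_mean (R : realType) (i : interval R) (k : R -> R) (k0 e l : R) :
  lebesgue_measure ([set` i] : set R) = l%:E ->
  (@lebesgue_measure R).-integrable setT (EFin \o k) ->
  (forall t, t \in i -> `|k t - k0| <= e) ->
  `|\int[lebesgue_measure]_(t in [set` i]) k t - k0 * l| <= e * l.
Proof.
set D := [set` i]; move=> Dl ik ke; have mD := measurable_itv i; rewrite -/D in mD.
have ikD : (@lebesgue_measure R).-integrable D (EFin \o k).
  by apply: (@integrableS _ (measurableTypeR R) R lebesgue_measure setT D).
have Dfin : (lebesgue_measure D < +oo)%E by rewrite Dl ltry.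
have fc (c : R) : (@lebesgue_measure R).-integrable D (EFin \o (fun=> c)).
  apply: (@measurable_bounded_integrable _ (measurableTypeR R) R
    lebesgue_measure) => //.
  exact: bounded_cst.
have -> : k0 * l = \int[lebesgue_measure]_(t in D) k0.
  by rewrite (@Rintegral_cst _ (measurableTypeR R))//= Dl.
rewrite -(@RintegralB _ (measurableTypeR R) R lebesgue_measure)//.
have ikk : (@lebesgue_measure R).-integrable D (EFin \o (fun t => k t - k0)).
  rewrite /comp; under eq_fun do rewrite EFinB.
  by apply: (@integrableB _ (measurableTypeR R)) => //; exact: fc.
rewrite (le_trans (@le_normr_Rintegral _ (measurableTypeR R) R lebesgue_measure
  _ _ mD ikk))//.
have -> : e * l = \int[lebesgue_measure]_(t in D) e.
  by rewrite (@Rintegral_cst _ (measurableTypeR R))//= Dl.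
by apply: (@le_Rintegral _ (measurableTypeR R)) => //; exact: (integrable_norm ikk).
Qed.

Lemma sign_zero_set (R : realType) (p pt : R -> R -> R) (sg x t s : R) :
  (forall t s : R, is_derive t 1 (p^~ s) (pt t s)) ->
  (forall t s, 0 < sg * pt t s) -> sg = 1 \/ sg = -1 -> p x s = 0 ->
  (0 <= p t s) = (if 0 < sg then x <= t else t <= x).
Proof.
move=> dp pp sg1 px.
have [->|tx] := eqVneq t x; first by rewrite px !lexx if_same.
have := sign_change dp pp px tx.
case: sg1 => ->; rewrite ?ltr01 ?ltr0N1 => H.
  apply/idP/idP => h; nra.
by apply/idP/idP => h; nra.
Qed.

(** Between two parameters at which [p] has zeros [x] and [y], the set where
    [p] is nonnegative changes by an interval with end points [x] and [y]. *)
Lemma nonneg_set_jump (R : realType) (p pt : R -> R -> R) (sg x y s : R) :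
  (forall t s : R, is_derive t 1 (p^~ s) (pt t s)) ->
  (forall t s, 0 < sg * pt t s) -> sg = 1 \/ sg = -1 ->
  p x s = 0 -> p y 0 = 0 ->
  exists (i : interval R) (th : R), [/\ th * `|x - y| = - (sg * (x - y)),
    `|th| = 1, lebesgue_measure ([set` i] : set R) = `|x - y|%:E,
    forall t, t \in i -> `|t - y| <= `|x - y| &
    forall t, (0 <= p t s)%R%:R - (0 <= p t 0)%R%:R = th * (t \in i)%:R].
Proof.
move=> dp pp sg1 px py.
exists (Interval (BSide (0 < sg) (Num.min x y)) (BSide (0 < sg) (Num.max x y))).
exists (if x <= y then sg else - sg); split.
- case: leP => xy; first by rewrite ler0_norm ?subr_le0//; ring.
  by rewrite gtr0_norm ?subr_gt0//; ring.
- by case: ifP => _; case: sg1 => ->; rewrite ?normrN ?normrN1 ?normr1.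
- rewrite lebesgue_measure_itv /= lte_fin; case: (ltgtP x y) => xy.
  + by rewrite xy ltr0_norm ?subr_lt0// opprB -EFinB.
  + by rewrite xy gtr0_norm ?subr_gt0// -EFinB.
  + by rewrite ltxx xy subrr normr0.
- move=> t; rewrite in_itv/= => H.
  have [t1 t2] : Num.min x y <= t /\ t <= Num.max x y.
    by move: H; case: (0 < sg) => /= /andP[]; [move=> ? /ltW|move=> /ltW].
  have n1 := ler_norm (x - y); have n2 := ler_norm (y - x).
  rewrite (distrC y) in n2; rewrite ler_norml.
  by move: t1 t2; case: (leP x y) => xy t1 t2; apply/andP; split; lra.
- move=> t; rewrite (sign_zero_set t dp pp sg1 px) (sign_zero_set t dp pp sg1 py).
  rewrite in_itv/=.
  case: sg1 => ->; rewrite ?ltr01 ?ltr0N1 /=.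
    case: (leP x y) => xy; case: (leP x t) => xt; case: (leP y t) => yt /=;
      rewrite ?mulr1n ?mulr0n; try lra.
  case: (leP x y) => xy; case: (leP t x) => xt; case: (leP t y) => yt /=;
    rewrite ?mulr1n ?mulr0n; try lra.
Qed.

(** * Motion of a zero and of the half line it bounds *)

(** A level function that is strictly monotone in its first variable, of
    direction given by the sign [sg], with at most exponential inverse slope. *)
Record monotone_expo (R : realType) (p pt ps : R -> R -> R) (sg M : R) : Prop := {
  mono_C1 : C1_expo p pt ps M;
  mono_sg : sg = 1 \/ sg = -1;
  mono_gt0 : forall t s, 0 < sg * pt t s;
  mono_inv_le : forall t s, `|s| <= 1 -> `|pt t s|^-1 <= M * expR (M * `|t|) }.

Section level_crossing.
Context {R : realType}.
Variables (p pt ps : R -> R -> R) (sg M : R).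
Hypothesis pM : monotone_expo p pt ps sg M.
Variable z : R -> R.
Hypothesis hz : forall s, (exists t, p t s = 0) -> p (z s) s = 0.

Notation mu := lebesgue_measure.
Notation rho := (normal_pdf 0 1).

Let pC := mono_C1 pM.
Let M0 : 0 <= M. Proof. exact: C1_expo_ge0 pC. Qed.

(** The hypothesis says that [p] has no zero at parameter [0]. *)
Lemma no_zero : p (z 0) 0 != 0 -> forall t, p t 0 != 0.
Proof. by move=> /eqP pz t; apply/eqP => pt0; apply: pz; apply: hz; exists t. Qed.

(** The square of the estimate of [far_sign_change]. *)
Lemma crossing_far : p (z 0) 0 != 0 -> forall t s, `|s| <= 1 ->
  p t 0 * p t s <= 0 ->
  1 <= (M ^+ 2 * expR M) ^+ 2 * s ^+ 2 * expR (4 * M * `|t|).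
Proof.
move=> /no_zero nz t s s1 pts.
have := far_sign_change (C1_dt pC) (C1_ds pC) (mono_gt0 pM) M0
  (C1_ds_le pC) (mono_inv_le pM) nz s1 pts.
set a := (X in 1 <= X) => a1.
have : 1 <= a ^+ 2 by rewrite expr_ge1// (le_trans ler01).
move=> /le_trans; apply; rewrite /a !exprMn real_normK ?num_real//.
have -> : 4 * M * `|t| = 2%:R * ((M + M) * `|t|) by ring.
by rewrite [in leRHS]expRM_natl !mulrA.
Qed.

Section crossing_integral.
Variables k kt ks : R -> R -> R.
Hypothesis kM : C1_expo k kt ks M.

(** Change of the indicator of [p >= 0] between the parameters [0] and [s]. *)
Definition jump (t s : R) : R := (0 <= p t s)%R%:R - (0 <= p t 0)%R%:R.

Lemma measurable_slice (q qt qs : R -> R -> R) (s : R) :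
  C1_expo q qt qs M -> measurable_fun setT (q^~ s).
Proof.
by move=> qC; exact: (@derivative_measurable R _ (qt^~ s) (fun t => C1_dt qC t s)).
Qed.

Lemma measurable_jump (s : R) : measurable_fun setT (jump^~ s).
Proof.
by apply: measurable_funB; apply: measurable_nonneg; exact: measurable_slice pC.
Qed.

Lemma jump_le1 (t s : R) : `|jump t s| <= 1.
Proof.
rewrite /jump; case: (0 <= p t s); case: (0 <= p t 0);
by rewrite ?mulr1n ?mulr0n ?subrr ?subr0 ?sub0r ?normrN ?normr0 ?normr1.
Qed.

(** Without a zero at parameter [0], the indicator changes only where
    [crossing_far] applies, so the integral is of order [s ^+ 2]. *)
Lemma crossing_quotient_far : p (z 0) 0 != 0 ->
  (\int[mu]_t (k t s * jump t s * rho t)) / s @[s --> 0^'] --> 0.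
Proof.
move=> nz.
apply: (@quadratic_quotient_cvg0 R _
  (M * (M ^+ 2 * expR M) ^+ 2 * expo_moment (M + 4 * M))).
move=> s s1.
have -> : M * (M ^+ 2 * expR M) ^+ 2 * expo_moment (M + 4 * M) * s ^+ 2 =
    M * (M ^+ 2 * expR M) ^+ 2 * s ^+ 2 * expo_moment (M + 4 * M) by ring.
apply: (@integral_normal_weight_le R (fun t => k t s * jump t s)).
- by rewrite addr_ge0// mulr_ge0.
- by apply: measurable_funM; [exact: measurable_slice kM|exact: measurable_jump].
- move=> t; rewrite normrM mulrDl expRD.
  have -> : M * (M ^+ 2 * expR M) ^+ 2 * s ^+ 2 *
      (expR (M * `|t|) * expR (4 * M * `|t|)) =
      (M * expR (M * `|t|)) *
      ((M ^+ 2 * expR M) ^+ 2 * s ^+ 2 * expR (4 * M * `|t|)) by ring.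
  rewrite ler_pM//; first exact: C1_le kM _ _ s1.
  have [pts|pts] := leP (p t 0 * p t s) 0.
    by rewrite (le_trans (jump_le1 t s))// crossing_far.
  have -> : jump t s = 0.
    rewrite /jump; apply/eqP; rewrite subr_eq0; apply/eqP.
    congr (nat_of_bool _)%:R; move: pts.
    have [h|h|->] := ltgtP (p t 0) 0; last by rewrite mul0r ltxx.
      by rewrite nmulr_rgt0// => h'; rewrite leNgt h'.
    by rewrite pmulr_rgt0// => /ltW ->.
  by rewrite normr0 mulr_ge0 ?expR_ge0// mulr_ge0// sqr_ge0.
Qed.

(** With a zero at parameter [0], the indicator changes on an interval of length
    [|z s - z 0|] that shrinks to [z 0]. *)
Lemma crossing_quotient_near : p (z 0) 0 = 0 ->
  (\int[mu]_t (k t s * jump t s * rho t)) / s @[s --> 0^'] -->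
    sg * (k (z 0) 0 * (ps (z 0) 0 / pt (z 0) 0)) * rho (z 0).
Proof.
move=> p0; set t0 := z 0.
pose J s := \int[mu]_t (k t s * jump t s * rho t).
set k0 := k t0 0 * rho t0.
have zc := zero_curve_cvg (C1_dt pC) (mono_gt0 pM) (C1_cont pC) p0 hz.
have zd := zero_curve_derivative (C1_dt pC) (C1_ds pC) (mono_gt0 pM)
  (C1_cont pC) (C1_cont_dt pC) (C1_cont_ds pC) p0 hz.
rewrite -/t0 in zc zd.
have ex := zero_persists (C1_dt pC) (mono_gt0 pM) (C1_cont pC) p0 ltr01.
(* [m s] is, up to sign, the mean of the integrand over that interval. *)
pose m s := if z s == t0 then - (sg * k0) else J s / (z s - t0).
have Je (e s : R) : `|s| <= 1 -> p (z s) s = 0 ->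
    (forall t, `|t - t0| <= `|z s - t0| -> `|k t s * rho t - k0| <= e) ->
    `|J s + sg * k0 * (z s - t0)| <= e * `|z s - t0|.
  move=> s1 pzs ke.
  have [i [th [th1 th2 mi ti ji]]] :=
    nonneg_set_jump (C1_dt pC) (mono_gt0 pM) (mono_sg pM) pzs p0.
  rewrite -/t0 in th1 th2 mi ti ji.
  have ik : mu.-integrable setT (EFin \o (fun t => k t s * rho t)).
    apply: (@integrable_normal_weight R _ M M) => //.
      exact: measurable_slice kM.
    by move=> t; exact: C1_le kM _ _ s1.
  have -> : J s = th * \int[mu]_(t in [set` i]) (k t s * rho t).
    rewrite -RintegralZl//; last first.
      by apply: (@integrableS _ (measurableTypeR R) R mu setT).
    rewrite [RHS]Rintegral_mkcond; apply: eq_Rintegral => t _.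
    rewrite /jump ji patchE mem_setE; case: (t \in i); rewrite ?mulr1n ?mulr0n.
      by ring.
    by rewrite !mulr0 mul0r.
  have -> : sg * k0 * (z s - t0) = - (th * (k0 * `|z s - t0|)).
    by rewrite [in RHS]mulrCA th1; ring.
  rewrite -mulrBr normrM th2 mul1r.
  by apply: interval_mean => // t it; apply: ke; exact: ti.
have mc : m s @[s --> 0^'] --> - (sg * k0).
  apply/cvgrPdist_le => e e0.
  have kr : jcont (fun t s => k t s * rho t) t0.
    apply: jcontM; first exact: C1_cont kM _.
    by apply: jcont_fst; apply: continuous_normal_pdf; exact: oner_neq0.
  have [dl dl0 kd] := kr _ e0.
  have n1 : \forall s \near (0:R)^', `|s| < 1 by apply: cvg_within; exact: near0_lt.
  have n2 : \forall s \near (0:R)^', `|s| < dl by apply: cvg_within; exact: near0_lt.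
  have n3 : \forall s \near (0:R)^', `|z s - t0| < dl.
    by apply: cvg_within; exact: (cvgr_distC_lt _ _ zc _ dl0).
  have n4 : \forall s \near (0:R)^', exists2 x, `|x - t0| < 1 & p x s = 0.
    exact: cvg_within.
  near=> s.
  rewrite /m; case: eqVneq => [zs|zs]; first by rewrite subrr normr0 ltW.
  have z0 : 0 < `|z s - t0| by rewrite normr_gt0 subr_eq0.
  have : `|J s + sg * k0 * (z s - t0)| <= e * `|z s - t0|.
    apply: Je.
    - by apply: ltW; near: s.
    - have [x _ px] : exists2 x, `|x - t0| < 1 & p x s = 0 by near: s.
      by apply: hz; exists x.
    - move=> t tz; apply/ltW/kd; last by near: s.
      by rewrite (le_lt_trans tz)//; near: s.
  rewrite -ler_pdivrMr// -normrV ?unitfE ?subr_eq0// -normrM mulrDl.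
  rewrite mulfK ?subr_eq0//.
  by rewrite -opprD normrN addrC.
rewrite (_ : sg * _ * _ = - (sg * k0) * - (ps t0 0 / pt t0 0)); last first.
  by rewrite /k0; ring.
apply: cvg_trans (cvgM mc zd).
apply: near_eq_cvg.
have n1 : \forall s \near (0:R)^', `|s| < 1 by apply: cvg_within; exact: near0_lt.
have n4 : \forall s \near (0:R)^', exists2 x, `|x - t0| < 1 & p x s = 0.
  exact: cvg_within.
near=> s; rewrite /= mulrA; congr (_ / _).
rewrite /m; case: eqVneq => [zs|zs]; last by rewrite divfK// subr_eq0.
rewrite zs subrr mulr0.
have := Je (`|k t0 s * rho t0 - k0|) s.
rewrite zs subrr normr0 !mulr0 addr0 normr_le0 => H; apply/esym/eqP/H.
- by apply: ltW; near: s.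
- have [x _ px] : exists2 x, `|x - t0| < 1 & p x s = 0 by near: s.
  by rewrite -zs; apply: hz; exists x.
- by move=> t; rewrite normr_le0 subr_eq0 => /eqP ->.
Unshelve. all: by end_near. Qed.


(** Derivative at parameter [0] of the integral of [k] times the normal density
    over the set where [p] is nonnegative: the boundary point contributes only
    if it exists at parameter [0]. *)
Lemma half_integral_derivative :
  (\int[mu]_t (k t s * (0 <= p t s)%R%:R * rho t) -
   \int[mu]_t (k t 0 * (0 <= p t 0)%R%:R * rho t)) / s @[s --> 0^'] -->
  \int[mu]_t (ks t 0 * (0 <= p t 0)%R%:R * rho t) +
  (if p (z 0) 0 == 0 then
     sg * (k (z 0) 0 * (ps (z 0) 0 / pt (z 0) 0)) * rho (z 0) else 0).
Proof.
have H : (\int[mu]_t (k t s * jump t s * rho t)) / s @[s --> 0^'] -->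
    (if p (z 0) 0 == 0 then
       sg * (k (z 0) 0 * (ps (z 0) 0 / pt (z 0) 0)) * rho (z 0) else 0).
  case: eqP => [|/eqP] pz; first exact: crossing_quotient_near.
  exact: crossing_quotient_far.
have b1 t : `|(0 <= p t 0)%R%:R : R| <= 1.
  by case: (0 <= p t 0); rewrite ?normr0 ?normr1.
have m1 s : measurable_fun setT (fun t => (0 <= p t s)%R%:R : R).
  by apply: measurable_nonneg; exact: measurable_slice pC.
have ik (s : R) (chi : R -> R) : `|s| <= 1 -> measurable_fun setT chi ->
    (forall t, `|chi t| <= 1) ->
    mu.-integrable setT (EFin \o (fun t => k t s * chi t * rho t)).
  move=> s1 mchi chi1.
  apply: (@integrable_normal_weight R (fun t => k t s * chi t) M M) => //.
    by apply: measurable_funM => //; exact: measurable_slice kM.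
  move=> t; rewrite normrM -[leRHS]mulr1 ler_pM//; exact: C1_le kM _ _ s1.
(* The indicator is first frozen at parameter [0]; its change is [jump]. *)
apply: cvg_trans (cvgD (weighted_integral_derivative kM (m1 0) b1) H).
apply: near_eq_cvg.
have n1 : \forall s \near (0:R)^', `|s| < 1 by apply: cvg_within; exact: near0_lt.
near=> s; rewrite /= -mulrDl; congr (_ / _).
have s1 : `|s| <= 1 by apply: ltW; near: s.
rewrite [LHS]addrAC; congr (_ - _).
rewrite -RintegralD//; last 2 first.
- exact: ik (m1 0) b1.
- exact: ik (measurable_jump s) (jump_le1^~ s).
by apply: eq_Rintegral => t _; rewrite /jump; ring.
Unshelve. all: by end_near. Qed.

End crossing_integral.

(** Derivative at parameter [0] of the value of [h] times the normal density at
    the zero of [p]. It vanishes if there is no zero at parameter [0], because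
    the zeros at parameters [s] close to [0] lie far away, where the normal
    density dominates. *)
Lemma level_crossing_derivative (h ht hs : R -> R -> R) :
  C1_expo h ht hs M ->
  ((if p (z s) s == 0 then h (z s) s * rho (z s) else 0) -
   (if p (z 0) 0 == 0 then h (z 0) 0 * rho (z 0) else 0)) / s @[s --> 0^'] -->
  (if p (z 0) 0 == 0 then
     (hs (z 0) 0 - ps (z 0) 0 / pt (z 0) 0 * (ht (z 0) 0 - z 0 * h (z 0) 0)) *
     rho (z 0)
   else 0).
Proof.
move=> hM; case: eqP => [pz|/eqP pz]; last first.
  have c0 : 0 <= M + 4 * M by rewrite addr_ge0// mulr_ge0.
  have [C C0 CP] := expo_normal_pdf_bounded c0; under eq_fun do rewrite subr0.
  apply: (@quadratic_quotient_cvg0 R _ (M * (M ^+ 2 * expR M) ^+ 2 * C)) => s s1.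
  have [pzs|_] := eqVneq; last first.
    by rewrite normr0 mulr_ge0 ?sqr_ge0// !mulr_ge0 ?expR_ge0.
  have := crossing_far pz (t := z s) s1; rewrite pzs mulr0 lexx => /(_ isT) far.
  rewrite normrM (ger0_norm (normal_pdf_ge0 _ _ _)).
  have := C1_le hM (z s) s1.
  have := CP (z s); rewrite mulrDl expRD.
  set a := `|h (z s) s|; set r := rho (z s); set E := expR (M * _).
  set E4 := expR (4 * M * _) in far *; set K := (_ ^+ 2 * _) ^+ 2 in far *.
  move=> cp ha.
  have r0 : 0 <= r by exact: normal_pdf_ge0.
  have E0 : 0 <= E by exact: expR_ge0.
  have K0 : 0 <= K by exact: sqr_ge0.
  apply: (@le_trans _ _ (M * E * (K * s ^+ 2 * E4) * r)).
    by rewrite ler_wpM2r// -[leLHS]mulr1 ler_pM// /a normr_ge0.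
  have -> : M * E * (K * s ^+ 2 * E4) * r = M * K * s ^+ 2 * (E * E4 * r) by ring.
  have -> : M * K * C * s ^+ 2 = M * K * s ^+ 2 * C by ring.
  by rewrite ler_wpM2l// mulr_ge0 ?sqr_ge0// mulr_ge0.
set t0 := z 0.
have dq (t s : R) : is_derive t 1 (fun t => h t s * rho t)
    ((ht t s - t * h t s) * rho t).
  have h1 := C1_dt hM t s; have h2 := derive_normal_pdf t.
  have /is_derive_eq := @is_deriveM R R (h^~ s) rho t 1 _ _ h1 h2.
  by apply; rewrite /GRing.scale/=; ring.
have dqs (t s : R) : is_derive s 1 (fun s => h t s * rho t) (hs t s * rho t).
  have := is_deriveZ (rho t) (C1_ds hM t s).
  rewrite (_ : rho t \*: h t = fun s => h t s * rho t); last first.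
    by apply/funext => x; rewrite /= /GRing.scale/= mulrC.
  by rewrite /GRing.scale/= mulrC.
have rc t : jcont (fun t _ => rho t) t.
  by apply: jcont_fst; apply: continuous_normal_pdf; exact: oner_neq0.
have cqt : jcont (fun t s => (ht t s - t * h t s) * rho t) t0.
  apply: (@jcontM R (fun t s => ht t s - t * h t s) (fun t _ => rho t)) => //.
  have -> : (fun t s => ht t s - t * h t s) = (fun t s => ht t s + (- t) * h t s).
    by apply/funext => t; apply/funext => s; ring.
  apply: (@jcontD R ht (fun t s => - t * h t s)); first exact: C1_cont_dt hM _.
  apply: (@jcontM R (fun t _ => - t) h); last exact: C1_cont hM _.
  by apply: (@jcont_fst R -%R); exact: opp_continuous.
have cqs : jcont (fun t s => hs t s * rho t) t0.
  by apply: (@jcontM R hs (fun t _ => rho t)) => //; exact: C1_cont_ds hM _.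
have := along_zero_curve (C1_dt pC) (C1_ds pC) (mono_gt0 pM) (C1_cont pC)
  (C1_cont_dt pC) (C1_cont_ds pC) dq dqs cqt cqs pz hz.
rewrite -/t0 mulrA -mulrBl; apply: cvg_trans.
apply: near_eq_cvg.
have ex := zero_persists (C1_dt pC) (mono_gt0 pM) (C1_cont pC) pz ltr01.
have n4 : \forall s \near (0:R)^', exists2 x, `|x - t0| < 1 & p x s = 0.
  exact: cvg_within.
near=> s.
have [x _ px] : exists2 x, `|x - t0| < 1 & p x s = 0 by near: s.
by rewrite hz ?eqxx//; exists x.
Unshelve. all: by end_near. Qed.

End level_crossing.

(** * Symmetry of mixed derivatives *)

Lemma derive_along_line (R : realType) (n : nat) (f : 'rV[R]_n -> R)
    (x v : 'rV[R]_n) (t : R) :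
  derivable f (x + t *: v) v ->
  is_derive t 1 (fun t => f (x + t *: v)) ('D_v f (x + t *: v)).
Proof.
have E : (fun h : R => h^-1 *: (((fun t => f (x + t *: v)) \o shift t) (h *: 1) -
      f (x + t *: v))) =
    (fun h : R => h^-1 *: ((f \o shift (x + t *: v)) (h *: v) - f (x + t *: v))).
  apply/funext => h /=; congr (_ *: (f _ - _)).
  by rewrite [h *: 1]mulr1 scalerDl addrCA.
by move=> d; apply: DeriveDef; rewrite /derivable /derive E.
Qed.

(** Schwarz's theorem in two variables: both mixed derivatives are close to the
    second difference of [F] over a small square, divided by its area. *)
Lemma mixed_partials_commute2 (R : realType) (F F1 F2 F12 F21 : R -> R -> R) :
  (forall a b : R, is_derive a 1 (F^~ b) (F1 a b)) ->
  (forall a b : R, is_derive b 1 (F a) (F2 a b)) ->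
  (forall a b : R, is_derive b 1 (F1 a) (F12 a b)) ->
  (forall a b : R, is_derive a 1 (F2^~ b) (F21 a b)) ->
  jcont F12 0 -> jcont F21 0 -> F12 0 0 = F21 0 0.
Proof.
move=> d1 d2 d12 d21 c12 c21; apply/eqP; rewrite -subr_eq0 -normr_le0 leNgt.
apply/negP => D0; set D := `|_| in D0.
have e0 : 0 < D / 2 by rewrite divr_gt0.
have [u u0 cu] := c12 _ e0; have [v v0 cv] := c21 _ e0.
pose h := Num.min u v / 2.
have h0 : 0 < h by rewrite divr_gt0// lt_min u0.
have [hu hv] : h < u /\ h < v.
  by rewrite /h; case: (ltP u v) => uv; split; lra.
have hn : `|h - 0| = h by rewrite subr0 gtr0_norm.
have [a [ah ea]] := @mean_value R (fun a => F a h - F a 0)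
  (fun a => F1 a h - F1 a 0) 0 h (fun a => is_deriveB (d1 a h) (d1 a 0)).
have [b [bh eb]] := @mean_value R (F1 a) (F12 a) 0 h (d12 a).
have [b' [bh' eb']] := @mean_value R (fun b => F h b - F 0 b)
  (fun b => F2 h b - F2 0 b) 0 h (fun b => is_deriveB (d2 h b) (d2 0 b)).
have [a' [ah' ea']] := @mean_value R (F2^~ b') (F21^~ b') 0 h (fun a => d21 a b').
rewrite hn in ah bh bh' ah'; rewrite !subr0 in eb ea eb' ea' bh bh'.
have H : F12 a b * h * h = F21 a' b' * h * h.
  by rewrite -eb -ea -ea' -eb'; ring.
have {}H : F12 a b = F21 a' b' by do 2![apply: (mulIf (lt0r_neq0 h0))].
have := cu a b (le_lt_trans ah hu) (le_lt_trans bh hu).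
have := cv a' b' (le_lt_trans ah' hv) (le_lt_trans bh' hv).
rewrite -H => h1 h2.
have : D <= `|F12 a b - F21 0 0| + `|F12 a b - F12 0 0|.
  rewrite /D (_ : F12 0 0 - F21 0 0 = (F12 a b - F21 0 0) - (F12 a b - F12 0 0)).
    exact: ler_normB.
  by ring.
lra.
Qed.

Lemma jcont_affine (R : realType) (n : nat) (h : 'rV[R]_n -> R)
    (x u v : 'rV[R]_n) (t0 : R) :
  continuous h -> jcont (fun t s => h (x + t *: u + s *: v)) t0.
Proof.
move=> hc; apply/jcontP.
apply: (@continuous_comp _ _ _ (fun z : R * R => x + z.1 *: u + z.2 *: v) h).
  apply: cvgD; first apply: cvgD; first exact: cvg_cst.
    by apply: cvgZr_tmp; exact: cvg_fst.
  by apply: cvgZr_tmp; exact: cvg_snd.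
exact: hc.
Qed.

Lemma partial_comm (R : realType) (n : nat) (i j : 'I_n) (f : 'rV[R]_n -> R) :
  (forall x, derivable f x (delta_mx 0 i)) ->
  (forall x, derivable f x (delta_mx 0 j)) ->
  (forall x, derivable (partial i f) x (delta_mx 0 j)) ->
  (forall x, derivable (partial j f) x (delta_mx 0 i)) ->
  continuous (partial i (partial j f)) -> continuous (partial j (partial i f)) ->
  partial i (partial j f) = partial j (partial i f).
Proof.
move=> di dj dij dji cij cji; apply/funext => x; apply/esym.
pose p (a b : R) : 'rV[R]_n := x + a *: delta_mx 0 i + b *: delta_mx 0 j.
have pC a b : p a b = (x + b *: delta_mx 0 j) + a *: delta_mx 0 i.
  by rewrite /p addrAC.
have dfi (f' : 'rV[R]_n -> R) (a b : R) :
    (forall x, derivable f' x (delta_mx 0 i)) ->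
    is_derive a 1 (fun a => f' (p a b)) (partial i f' (p a b)).
  move=> d; rewrite pC; under eq_fun do rewrite pC.
  by apply: derive_along_line; exact: d.
have dfj (f' : 'rV[R]_n -> R) (a b : R) :
    (forall x, derivable f' x (delta_mx 0 j)) ->
    is_derive b 1 (fun b => f' (p a b)) (partial j f' (p a b)).
  by move=> d; apply: derive_along_line; exact: d.
have p00 : p 0 0 = x by rewrite /p !scale0r !addr0.
have c1 : jcont (fun a b => partial j (partial i f) (p a b)) 0.
  exact: jcont_affine.
have c2 : jcont (fun a b => partial i (partial j f) (p a b)) 0.
  exact: jcont_affine.
have := @mixed_partials_commute2 R _ _ _ _ _ (fun a b => dfi f a b di)
  (fun a b => dfj f a b dj) (fun a b => dfj _ a b dij)
  (fun a b => dfi _ a b dji) c1 c2.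
by rewrite p00.
Qed.

(** By Schwarz's theorem the letters of a word of derivations of a [C^r]
    function may be moved to the front. *)
Lemma dword_move_front (R : realType) (n r : nat) (f : 'rV[R]_n -> R)
    (w1 w2 : seq 'I_n) (i : 'I_n) :
  Cr r f -> (size (w1 ++ i :: w2) <= r)%N ->
  dword (w1 ++ i :: w2) f = dword (i :: w1 ++ w2) f.
Proof.
move=> fr; elim: w1 => [//|a w1 IH] sw /=.
rewrite -/(dword _ _) -/(dword _ _) IH; last exact: ltnW.
have s1 : (size [:: a, i & w1 ++ w2] <= r)%N.
  by move: sw; rewrite /= !size_cat /= addnS.
have [/= [[_ di] dai] ca] := fr [:: a, i & w1 ++ w2] s1.
have [/= [[_ da] dia] ci] := fr [:: i, a & w1 ++ w2] s1.
exact: (partial_comm da di dia dai ca ci).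
Qed.

Lemma dword_perm (R : realType) (n r : nat) (f : 'rV[R]_n -> R)
    (w w' : seq 'I_n) :
  Cr r f -> (size w <= r)%N -> perm_eq w w' -> dword w f = dword w' f.
Proof.
move=> fr; elim: w w' => [|i w IH] w' sw.
  by rewrite perm_sym => /perm_nilP ->.
move=> pw; have iw' : i \in w' by rewrite -(perm_mem pw) mem_head.
have sw' : (size w' <= r)%N by rewrite -(perm_size pw).
case/splitPr: iw' pw sw' => w1 w2 pw sw'.
rewrite (dword_move_front fr sw') /= -!/(dword _ _) (IH (w1 ++ w2))//.
  exact: ltnW.
by move: pw; rewrite perm_sym perm_catC /= perm_cons perm_catC perm_sym.
Qed.

(** The word of the multi-index that counts the letters of [w] is [w] sorted. *)
Lemma mword_perm (n : nat) (w : seq 'I_n) :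
  perm_eq (mword (fun i => count_mem i w)) w.
Proof.
apply/allP => a _ /=; apply/eqP; rewrite /mword count_flatten -map_comp.
rewrite sumnE big_map big_enum /= (bigD1 a)//= count_nseq /= eqxx mul1n.
rewrite big1 ?addn0// => i ia; rewrite count_nseq /=.
by rewrite (negbTE ia) mul0n.
Qed.

Lemma size_mword (n : nat) (alpha : 'I_n -> nat) :
  size (mword alpha) = mdegree alpha.
Proof.
rewrite /mword size_flatten /shape -map_comp sumnE big_map big_enum /=.
by apply: eq_bigr => i _; rewrite /= size_nseq.
Qed.

Lemma mderiv_count (R : realType) (n r : nat) (f : 'rV[R]_n -> R)
    (w : seq 'I_n) :
  Cr r f -> (size w <= r)%N -> mderiv (fun i => count_mem i w) f = dword w f.
Proof.
move=> fr sw; apply: (dword_perm fr); last exact: mword_perm.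
by rewrite (perm_size (mword_perm w)).
Qed.

(** * Functions with exponentially bounded derivatives *)

(** At most exponential growth; one constant serves both as factor and as rate. *)
Definition expo_bounded (R : realType) (n : nat) (h : 'rV[R]_n -> R) : Prop :=
  exists M, forall x, `|h x| <= M * expR (M * eucl_norm x).

(** Functions of class [C^k] all of whose partial derivatives of order at most
    [k], in any order of derivation, grow at most exponentially. *)
Fixpoint Cexpo (R : realType) (n k : nat) (h : 'rV[R]_n -> R) : Prop :=
  (continuous h /\ expo_bounded h) /\
  match k with
  | 0%N => True
  | k'.+1 => forall i, (forall x, derivable h x (delta_mx 0 i)) /\
                       Cexpo k' (partial i h)
  end.

Lemma eucl_norm_ge0 (R : realType) (n : nat) (x : 'rV[R]_n) : 0 <= eucl_norm x.
Proof. exact: sqrtr_ge0. Qed.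

Lemma expo_mono (R : realType) (a b t : R) :
  0 <= a -> a <= b -> 0 <= t -> a * expR (a * t) <= b * expR (b * t).
Proof.
by move=> a0 ab t0; rewrite ler_pM ?expR_ge0// ler_expR ler_wpM2r.
Qed.

Lemma expo_bounded_ge0 (R : realType) (n : nat) (h : 'rV[R]_n -> R) (M : R) :
  (forall x, `|h x| <= M * expR (M * eucl_norm x)) -> 0 <= M.
Proof.
move=> /(_ 0) H; have := le_trans (normr_ge0 _) H.
by rewrite pmulr_lge0// expR_gt0.
Qed.

Lemma expo_bounded_intro (R : realType) (n : nat) (h : 'rV[R]_n -> R) (L A : R) :
  (forall x, `|h x| <= L * expR (A * eucl_norm x)) -> expo_bounded h.
Proof.
move=> hb; have L0 : 0 <= L.
  by have := le_trans (normr_ge0 _) (hb 0); rewrite pmulr_lge0// expR_gt0.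
exists (Num.max L A) => x; rewrite (le_trans (hb x))//.
rewrite ler_pM ?expR_ge0 ?le_max ?lexx// ler_expR ler_wpM2r ?eucl_norm_ge0//.
by rewrite le_max lexx orbT.
Qed.

Lemma expo_boundedD (R : realType) (n : nat) (u v : 'rV[R]_n -> R) :
  expo_bounded u -> expo_bounded v -> expo_bounded (fun x => u x + v x).
Proof.
move=> [a ua] [b vb]; have [a0 b0] := (expo_bounded_ge0 ua, expo_bounded_ge0 vb).
exists (a + b) => x; rewrite (le_trans (ler_normD _ _))// mulrDl.
have ab : a <= a + b by rewrite lerDl.
have ba : b <= a + b by rewrite lerDr.
rewrite lerD// ?(le_trans (ua x))// ?(le_trans (vb x))// ler_wpM2l// ler_expR.
  by rewrite ler_wpM2r ?eucl_norm_ge0.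
by rewrite ler_wpM2r ?eucl_norm_ge0.
Qed.

Lemma expo_boundedM (R : realType) (n : nat) (u v : 'rV[R]_n -> R) :
  expo_bounded u -> expo_bounded v -> expo_bounded (fun x => u x * v x).
Proof.
move=> [a ua] [b vb]; have [a0 b0] := (expo_bounded_ge0 ua, expo_bounded_ge0 vb).
exists (a * b + (a + b)) => x; rewrite normrM.
apply: (@le_trans _ _ ((a * b) * expR ((a + b) * eucl_norm x))).
  by rewrite mulrDl expRD mulrACA ler_pM.
rewrite ler_pM ?expR_ge0 ?mulr_ge0//; first by rewrite lerDl addr_ge0.
by rewrite ler_expR ler_wpM2r ?eucl_norm_ge0// lerDr mulr_ge0.
Qed.

Lemma expo_bounded_cst (R : realType) (n : nat) (c : R) :
  expo_bounded (fun _ : 'rV[R]_n => c).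
Proof.
exists `|c| => x; rewrite ler_peMr// -[leLHS]expR0 ler_expR.
by rewrite mulr_ge0// eucl_norm_ge0.
Qed.

Lemma coord_le_eucl_norm (R : realType) (n : nat) (x : 'rV[R]_n) (j : 'I_n) :
  `|x 0 j| <= eucl_norm x.
Proof.
rewrite -sqrtr_sqr /eucl_norm ler_sqrt ?sumr_ge0//; last by move=> i _; exact: sqr_ge0.
by rewrite (bigD1 j)//= lerDl sumr_ge0// => i _; exact: sqr_ge0.
Qed.

Lemma expo_bounded_coord (R : realType) (n : nat) (j : 'I_n) :
  expo_bounded (fun x : 'rV[R]_n => x 0 j).
Proof.
exists 1 => x; rewrite !mul1r (le_trans (coord_le_eucl_norm x j))//.
by rewrite (le_trans _ (expR_ge1Dx _))// lerDr.
Qed.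

Lemma Cexpo_S (R : realType) (n k : nat) (h : 'rV[R]_n -> R) :
  Cexpo k.+1 h -> Cexpo k h.
Proof.
elim: k h => [|k IH] h [hh dh]; split => // i.
by have [d1 d2] := dh i; split => //; exact: IH.
Qed.

Lemma Cexpo_le (R : realType) (n k m : nat) (h : 'rV[R]_n -> R) :
  (k <= m)%N -> Cexpo m h -> Cexpo k h.
Proof.
elim: m => [|m IH]; first by rewrite leqn0 => /eqP ->.
by rewrite leq_eqVlt => /orP[/eqP ->//|km] /Cexpo_S; exact: IH.
Qed.

Lemma Cexpo_cst (R : realType) (n k : nat) (c : R) :
  Cexpo k (fun _ : 'rV[R]_n => c).
Proof.
have c0 (a : R) : continuous (fun _ : 'rV[R]_n => a) by exact: cst_continuous.
elim: k c => [|k IH] c; first by split => //; split => //; exact: expo_bounded_cst.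
split => [|i]; first by split => //; exact: expo_bounded_cst.
split; first by move=> x; exact: derivable_cst.
have -> : partial i (fun _ : 'rV[R]_n => c) = fun=> 0.
  by apply/funext => x; exact: derive_cst.
exact: IH.
Qed.

Lemma CexpoD (R : realType) (n k : nat) (u v : 'rV[R]_n -> R) :
  Cexpo k u -> Cexpo k v -> Cexpo k (fun x => u x + v x).
Proof.
elim: k u v => [|k IH] u v [[cu bu] du] [[cv bv] dv].
  by split => //; split; [move=> x; exact: cvgD (cu x) (cv x)|exact: expo_boundedD].
split.
  by split; [move=> x; exact: cvgD (cu x) (cv x)|exact: expo_boundedD].
move=> i; have [[u1 u2] [v1 v2]] := (du i, dv i); split.
  by move=> x; exact: derivableD.
have -> : partial i (fun x => u x + v x) = fun x => partial i u x + partial i v x.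
  by apply/funext => x; exact: deriveD.
exact: IH.
Qed.

Lemma CexpoM (R : realType) (n k : nat) (u v : 'rV[R]_n -> R) :
  Cexpo k u -> Cexpo k v -> Cexpo k (fun x => u x * v x).
Proof.
elim: k u v => [|k IH] u v.
  move=> [[cu bu] du] [[cv bv] dv]; split => //; split; last exact: expo_boundedM.
  by move=> x; exact: cvgM (cu x) (cv x).
move=> uk vk; have [[cu bu] du] := uk; have [[cv bv] dv] := vk; split.
  by split; [move=> x; exact: cvgM (cu x) (cv x)|exact: expo_boundedM].
move=> i; have [[u1 u2] [v1 v2]] := (du i, dv i); split.
  by move=> x; exact: derivableM.
have -> : partial i (fun x => u x * v x) =
    fun x => u x * partial i v x + v x * partial i u x.
  by apply/funext => x; exact: deriveM.
by apply: CexpoD; apply: IH => //; exact: Cexpo_S.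
Qed.

Lemma CexpoZ (R : realType) (n k : nat) (c : R) (u : 'rV[R]_n -> R) :
  Cexpo k u -> Cexpo k (fun x => c * u x).
Proof. by move=> uk; apply: CexpoM => //; exact: Cexpo_cst. Qed.

Lemma CexpoB (R : realType) (n k : nat) (u v : 'rV[R]_n -> R) :
  Cexpo k u -> Cexpo k v -> Cexpo k (fun x => u x - v x).
Proof.
move=> uk vk; under eq_fun do rewrite -mulN1r.
by apply: CexpoD => //; exact: CexpoZ.
Qed.

Lemma CexpoV (R : realType) (n k : nat) (u : 'rV[R]_n -> R) :
  Cexpo k u -> (forall x, u x != 0) -> expo_bounded (fun x => (u x)^-1) ->
  Cexpo k (fun x => (u x)^-1).
Proof.
move=> uk u0 bv; elim: k uk => [|k IH] uk.
  by split => //; split => // x; have [[cu _] _] := uk; exact: cvgV (u0 x) (cu x).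
have [[cu bu] du] := uk; split.
  by split => // x; exact: cvgV (u0 x) (cu x).
move=> i; have [u1 u2] := du i; split.
  by move=> x; exact: derivableV.
have -> : partial i (fun x => (u x)^-1) =
    fun x => -1 * ((u x)^-1 * (u x)^-1 * partial i u x).
  apply/funext => x; rewrite /partial deriveV// /GRing.scale/= mulN1r mulNr.
  by rewrite expr2 invfM.
have vk := IH (Cexpo_S uk).
by apply: CexpoZ; apply: CexpoM => //; exact: CexpoM.
Qed.

Lemma is_derive_coord (R : realType) (n : nat) (i j : 'I_n) (x : 'rV[R]_n) :
  is_derive x (delta_mx 0 i) (fun x : 'rV[R]_n => x 0 j : R) ((j == i)%:R).
Proof.
have H : h^-1 *: (((fun x : 'rV[R]_n => x 0 j : R) \o shift x)
    (h *: (delta_mx 0 i)) - x 0 j) @[h --> 0^'] --> ((j == i)%:R : R).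
  apply: cvg_trans (@cvg_cst _ _ _ (0^') _).
  apply: near_eq_cvg; near=> h.
  have h0 : h != 0 by near: h; exact: nbhs_dnbhs_neq.
  by rewrite /= !mxE eqxx addrK /GRing.scale/= mulKf.
apply: DeriveDef; first by apply/cvg_ex; exists ((j == i)%:R : R).
exact: cvg_lim H.
Unshelve. all: by end_near. Qed.

Lemma Cexpo_coord (R : realType) (n k : nat) (j : 'I_n) :
  Cexpo k (fun x : 'rV[R]_n => x 0 j).
Proof.
have c : continuous (fun x : 'rV[R]_n => x 0 j) by exact: coord_continuous.
have b := @expo_bounded_coord R n j.
case: k => [|k]; split => // i; split.
  by move=> x; have [] := is_derive_coord i j x.
have -> : partial i (fun x : 'rV[R]_n => x 0 j) = fun=> (j == i)%:R.
  by apply/funext => x; have [] := is_derive_coord i j x.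
exact: Cexpo_cst.
Qed.

(** The bounds on the derivatives in the fixed order of [mderiv] extend to all
    orders of derivation by [mderiv_count]. *)
Lemma Cr_Cexpo (R : realType) (n r : nat) (h : 'rV[R]_n -> R) (L A : R) :
  Cr r h ->
  (forall x alpha, (mdegree alpha <= r)%N ->
    `|mderiv alpha h x| <= L * expR (A * eucl_norm x)) ->
  Cexpo r h.
Proof.
move=> hr hb.
have base w : (size w <= r)%N ->
    continuous (dword w h) /\ expo_bounded (dword w h).
  move=> sw; split; first by have [] := hr w sw.
  apply: (@expo_bounded_intro _ _ _ L A) => x; rewrite -(mderiv_count hr sw).
  by apply: hb; rewrite -size_mword (perm_size (mword_perm w)).
suff H k w : (size w + k <= r)%N -> Cexpo k (dword w h) by exact: (H r [::]).
elim: k w => [|k IH] w sw.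
  by split => //; apply: base; rewrite -(addn0 (size w)).
have sw0 : (size w <= r)%N by rewrite (leq_trans _ sw)// leq_addr.
split => [|i]; first exact: base.
have siw : (size (i :: w) <= r)%N by rewrite (leq_trans _ sw)//= addnS ltnS leq_addr.
have [[_ diw] _] := hr (i :: w) siw.
by split => //; apply: (IH (i :: w)); rewrite /= addSnnS.
Qed.

(** * First derivatives of preintegrals *)

Lemma insert_coord_affine (R : realType) (d : nat) (j : 'I_d) (k : 'I_d.-1)
    (y : 'rV[R]_d.-1) (t s : R) :
  insert_coord j t (y + s *: delta_mx 0 k) =
  insert_coord j 0 y + t *: delta_mx 0 j + s *: delta_mx 0 (lift j k).
Proof.
apply/rowP => i; rewrite !mxE eqxx /=; case: unliftP => [k' ->|->].
  rewrite !mxE eqxx /= (inj_eq lift_inj).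
  by rewrite [lift j k' == j]eq_sym (negbTE (neq_lift j k')) mulr0 addr0.
by rewrite eqxx (negbTE (neq_lift j k)) mulr1 mulr0 addr0 add0r.
Qed.

Lemma insert_coord_line (R : realType) (d : nat) (j : 'I_d)
    (y : 'rV[R]_d.-1) (t : R) :
  insert_coord j t y = insert_coord j 0 y + t *: delta_mx 0 j.
Proof.
apply/rowP => i; rewrite !mxE eqxx /=; case: unliftP => [k' ->|->].
  by rewrite [lift j k' == j]eq_sym (negbTE (neq_lift j k')) mulr0 addr0.
by rewrite eqxx mulr1 add0r.
Qed.

Lemma insert_coord_self (R : realType) (d : nat) (j : 'I_d)
    (y : 'rV[R]_d.-1) (t : R) : insert_coord j t y 0 j = t.
Proof. by rewrite mxE unlift_none. Qed.

Lemma eucl_norm_insert (R : realType) (d : nat) (j : 'I_d)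
    (y : 'rV[R]_d.-1) (t : R) :
  eucl_norm (insert_coord j t y) <= `|t| + eucl_norm y.
Proof.
have n0 := eucl_norm_ge0 y.
rewrite -(@ler_pXn2r _ 2)// ?nnegrE ?eucl_norm_ge0 ?addr_ge0//.
rewrite sqr_sqrtr ?sumr_ge0//; last by move=> i _; exact: sqr_ge0.
rewrite (bigD1_ord j)//= insert_coord_self.
under eq_bigr do rewrite mxE liftK.
have -> : \sum_(i < d.-1) y 0 i ^+ 2 = eucl_norm y ^+ 2.
  by rewrite sqr_sqrtr// sumr_ge0// => i _; exact: sqr_ge0.
rewrite sqrrD real_normK ?num_real// lerD2r lerDl mulrn_wge0// mulr_ge0//.
Qed.

Lemma eucl_norm_shift (R : realType) (n : nat) (k : 'I_n) (y : 'rV[R]_n) (s : R) :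
  eucl_norm (y + s *: delta_mx 0 k) <= eucl_norm y + `|s|.
Proof.
have n0 := eucl_norm_ge0 y.
rewrite -(@ler_pXn2r _ 2)// ?nnegrE ?eucl_norm_ge0 ?addr_ge0//.
rewrite sqr_sqrtr ?sumr_ge0//; last by move=> i _; exact: sqr_ge0.
have e : \sum_(i < n) y 0 i ^+ 2 = eucl_norm y ^+ 2.
  by rewrite sqr_sqrtr// sumr_ge0// => i _; exact: sqr_ge0.
rewrite (bigD1 k)//=; rewrite (bigD1 k)//= in e.
rewrite (eq_bigr (fun i => y 0 i ^+ 2)); last first.
  by move=> i ik; rewrite !mxE eqxx (negbTE ik) mulr0 addr0.
rewrite !mxE !eqxx mulr1 sqrrD -addrA (addrC _ (\sum_(_ < _ | _) _)).
rewrite sqrrD -e real_normK ?num_real//.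
have : y 0 k * s <= eucl_norm y * `|s|.
  rewrite (le_trans (ler_norm _))// normrM ler_wpM2r//.
  exact: coord_le_eucl_norm.
rewrite !mulr2n; lra.
Qed.

(** In a neighbourhood of [y] the growth of [h] is exponential in the coordinate
    [j] alone. The bound holds for all larger constants too, so that a single
    one can serve several functions. *)
Lemma slice_expo (R : realType) (d : nat) (j : 'I_d) (k : 'I_d.-1)
    (h : 'rV[R]_d -> R) (y : 'rV[R]_d.-1) :
  expo_bounded h -> exists M, forall M', M <= M' -> forall t s, `|s| <= 1 ->
    `|h (insert_coord j t (y + s *: delta_mx 0 k))| <= M' * expR (M' * `|t|).
Proof.
move=> [a ha]; have a0 := expo_bounded_ge0 ha.
exists (Num.max a (a * expR (a * (eucl_norm y + 1)))) => M'.
rewrite ge_max => /andP[aM aM'] t s s1; rewrite (le_trans (ha _))//.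
apply: (@le_trans _ _ (a * expR (a * (eucl_norm y + 1)) * expR (a * `|t|))).
  rewrite -mulrA -expRD ler_wpM2l// ler_expR -mulrDr ler_wpM2l//.
  rewrite (le_trans (eucl_norm_insert _ _ _))// addrC lerD2r.
  by rewrite (le_trans (eucl_norm_shift _ _ _))// lerD2l.
by rewrite ler_pM ?expR_ge0// ?mulr_ge0 ?expR_ge0// ler_expR ler_wpM2r.
Qed.

Lemma slice_C1_expo (R : realType) (d : nat) (j : 'I_d) (k : 'I_d.-1)
    (h : 'rV[R]_d -> R) (y : 'rV[R]_d.-1) :
  Cexpo 1 h -> exists M, forall M', M <= M' ->
  C1_expo (fun t s => h (insert_coord j t (y + s *: delta_mx 0 k)))
    (fun t s => partial j h (insert_coord j t (y + s *: delta_mx 0 k)))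
    (fun t s => partial (lift j k) h (insert_coord j t (y + s *: delta_mx 0 k))) M'.
Proof.
move=> [[hc hb] dh].
have [dj [[cj bj] _]] := dh j; have [dk [[ck bk] _]] := dh (lift j k).
have [a ha] := @slice_expo R d j k h y hb.
have [b hbb] := @slice_expo R d j k _ y bj.
have [c hcc] := @slice_expo R d j k _ y bk.
exists (Num.max a (Num.max b c)) => M'; rewrite !ge_max => /and3P[aM bM cM].
have cont (u : 'rV[R]_d -> R) t : continuous u ->
    jcont (fun t s => u (insert_coord j t (y + s *: delta_mx 0 k))) t.
  move=> uc; under eq_fun do under eq_fun do rewrite insert_coord_affine.
  exact: jcont_affine.
split.
- move=> t s; rewrite insert_coord_line.
  under eq_fun do rewrite insert_coord_line.
  exact: derive_along_line.
- move=> t s; rewrite insert_coord_affine.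
  under eq_fun do rewrite insert_coord_affine.
  exact: derive_along_line.
- by move=> t; exact: cont.
- by move=> t; exact: cont.
- by move=> t; exact: cont.
- exact: ha.
- exact: hbb.
- exact: hcc.
Qed.

(** The abscissa of the zero of [phi] on the line over [y], and [0] if there is
    none. *)
Definition zero_coord (R : realType) (d : nat) (j : 'I_d) (phi : 'rV[R]_d -> R)
    (y : 'rV[R]_d.-1) : R :=
  xget 0 [set t | phi (insert_coord j t y) = 0].

(** The value of [h] times the normal density at the zero of [phi] on the line
    over [y], extended by [0] to the lines without zero. *)
Definition boundary_term (R : realType) (d : nat) (j : 'I_d)
    (phi h : 'rV[R]_d -> R) (y : 'rV[R]_d.-1) : R :=
  let t := zero_coord j phi y in
  if phi (insert_coord j t y) == 0
  then h (insert_coord j t y) * normal_pdf 0 1 t else 0.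

(** The integral of [g] times the normal density over the part of the line over
    [y] where [phi] is nonnegative. *)
Definition half_integral (R : realType) (d : nat) (j : 'I_d)
    (phi g : 'rV[R]_d -> R) (y : 'rV[R]_d.-1) : R :=
  \int[lebesgue_measure]_t
    (g (insert_coord j t y) * (0 <= phi (insert_coord j t y))%R%:R *
     normal_pdf 0 1 t).

Lemma zero_coordP (R : realType) (d : nat) (j : 'I_d) (phi : 'rV[R]_d -> R)
    (y : 'rV[R]_d.-1) :
  (exists t, phi (insert_coord j t y) = 0) ->
  phi (insert_coord j (zero_coord j phi y) y) = 0.
Proof. by move=> [t pt]; rewrite /zero_coord; case: xgetP => [x _ //|/(_ t)]. Qed.

Lemma boundary_termD (R : realType) (d : nat) (j : 'I_d)
    (phi u v : 'rV[R]_d -> R) (y : 'rV[R]_d.-1) :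
  boundary_term j phi u y + boundary_term j phi v y =
  boundary_term j phi (fun x => u x + v x) y.
Proof. by rewrite /boundary_term; case: ifP; rewrite ?addr0// mulrDl. Qed.

Lemma partial_cvg (R : realType) (n : nat) (F : 'rV[R]_n -> R) (k : 'I_n)
    (y : 'rV[R]_n) (l : R) :
  (F (y + s *: delta_mx 0 k) - F (y + 0 *: delta_mx 0 k)) / s @[s --> 0^'] --> l ->
  derivable F y (delta_mx 0 k) /\ partial k F y = l.
Proof.
move=> H.
have H' : s^-1 *: ((F \o shift y) (s *: delta_mx 0 k) - F y) @[s --> 0^'] --> l.
  apply: cvg_trans H; apply: near_eq_cvg; apply: nearW => s.
  by rewrite /= scale0r addr0 (addrC y) [LHS]mulrC.
split; first by apply/cvg_ex; exists l.
exact: cvg_lim H'.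
Qed.

Section preintegration.
Context {R : realType}.
Variables (d : nat) (j : 'I_d) (phi : 'rV[R]_d -> R) (sg : R).
Hypothesis phiC : Cexpo 1 phi.
Hypothesis sg1 : sg = 1 \/ sg = -1.
Hypothesis phi_mono : forall x, 0 < sg * partial j phi x.
Hypothesis phi_inv : expo_bounded (fun x => (partial j phi x)^-1).

Lemma slice_monotone (k : 'I_d.-1) (y : 'rV[R]_d.-1) :
  exists M, forall M', M <= M' ->
  monotone_expo (fun t s => phi (insert_coord j t (y + s *: delta_mx 0 k)))
    (fun t s => partial j phi (insert_coord j t (y + s *: delta_mx 0 k)))
    (fun t s => partial (lift j k) phi (insert_coord j t (y + s *: delta_mx 0 k)))
    sg M'.
Proof.
have [a ha] := slice_C1_expo j k y phiC.
have [b hb] := @slice_expo R d j k _ y phi_inv.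
exists (Num.max a b) => M'; rewrite ge_max => /andP[aM bM].
split => //; first exact: ha.
by move=> t s s1; rewrite -normfV hb.
Qed.

(** The first derivative of an integral over [phi >= 0] is an integral of the
    same kind plus a boundary term. *)
Lemma half_integral_partial (k : 'I_d.-1) (g : 'rV[R]_d -> R) (y : 'rV[R]_d.-1) :
  Cexpo 1 g ->
  derivable (half_integral j phi g) y (delta_mx 0 k) /\
  partial k (half_integral j phi g) y =
  half_integral j phi (partial (lift j k) g) y +
  boundary_term j phi
    (fun x => sg * (g x * (partial (lift j k) phi x / partial j phi x))) y.
Proof.
move=> gC; have [a ha] := slice_monotone k y.
have [b hb] := slice_C1_expo j k y gC.
have aM : a <= Num.max a b by rewrite le_max lexx.
have bM : b <= Num.max a b by rewrite le_max lexx orbT.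
have hz (s : R) := @zero_coordP R d j phi (y + s *: delta_mx 0 k).
have [dF ->] := @partial_cvg R _ (half_integral j phi g) k y _
  (half_integral_derivative (ha _ aM) hz (hb _ bM)).
split => //.
by rewrite /half_integral /boundary_term scale0r addr0.
Qed.

(** Boundary terms are stable under derivation. *)
Lemma boundary_term_partial (k : 'I_d.-1) (h : 'rV[R]_d -> R) (y : 'rV[R]_d.-1) :
  Cexpo 1 h ->
  derivable (boundary_term j phi h) y (delta_mx 0 k) /\
  partial k (boundary_term j phi h) y =
  boundary_term j phi
    (fun x => partial (lift j k) h x - partial (lift j k) phi x / partial j phi x *
       (partial j h x - x 0 j * h x)) y.
Proof.
move=> hC; have [a ha] := slice_monotone k y.
have [b hb] := slice_C1_expo j k y hC.
have aM : a <= Num.max a b by rewrite le_max lexx.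
have bM : b <= Num.max a b by rewrite le_max lexx orbT.
have hz (s : R) := @zero_coordP R d j phi (y + s *: delta_mx 0 k).
have [dF ->] := @partial_cvg R _ (boundary_term j phi h) k y _
  (level_crossing_derivative (ha _ aM) hz (hb _ bM)).
split => //.
by rewrite /boundary_term scale0r addr0 insert_coord_self.
Qed.

End preintegration.

(** * Higher derivatives and the bounds *)

Lemma continuous_insert_coord (R : realType) (d : nat) (j : 'I_d)
    (h : 'rV[R]_d -> R) (y : 'rV[R]_d.-1) :
  continuous h -> continuous (fun t => h (insert_coord j t y)).
Proof.
move=> hc.
have -> : (fun t => h (insert_coord j t y)) =
    h \o (fun t : R => insert_coord j 0 y + t *: delta_mx 0 j).
  by apply/funext => t; rewrite /= -insert_coord_line.
move=> t; apply: continuous_comp; last exact: hc.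
apply: cvgD; first exact: cvg_cst.
by apply: cvgZr_tmp; exact: cvg_id.
Qed.

Lemma half_integrand_le (R : realType) (d : nat) (j : 'I_d)
    (phi g : 'rV[R]_d -> R) (M : R) (y : 'rV[R]_d.-1) (t : R) :
  (forall x, `|g x| <= M * expR (M * eucl_norm x)) ->
  `|g (insert_coord j t y) * (0 <= phi (insert_coord j t y))%R%:R| <=
  M * expR (M * eucl_norm y) * expR (M * `|t|).
Proof.
move=> gM; have M0 := expo_bounded_ge0 gM; set x := insert_coord j t y.
have b1 : `|(0 <= phi x)%R%:R : R| <= 1.
  by case: (0 <= phi x); rewrite ?normr0 ?normr1.
apply: (@le_trans _ _ `|g x|).
  by rewrite normrM -[leRHS]mulr1 ler_wpM2l.
rewrite (le_trans (gM x))// -mulrA -expRD ler_wpM2l// ler_expR -mulrDr ler_wpM2l//.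
by rewrite addrC eucl_norm_insert.
Qed.

Lemma measurable_half_integrand (R : realType) (d : nat) (j : 'I_d)
    (phi g : 'rV[R]_d -> R) (y : 'rV[R]_d.-1) :
  continuous phi -> continuous g ->
  measurable_fun setT (fun t : R => g (insert_coord j t y) *
    (0 <= phi (insert_coord j t y))%R%:R).
Proof.
move=> pc gc; apply: measurable_funM.
  by apply: continuous_measurable_fun; exact: continuous_insert_coord.
apply: measurable_nonneg.
by apply: continuous_measurable_fun; exact: continuous_insert_coord.
Qed.

Lemma half_integral_expo_bounded (R : realType) (d : nat) (j : 'I_d)
    (phi g : 'rV[R]_d -> R) :
  continuous phi -> continuous g -> expo_bounded g ->
  expo_bounded (half_integral j phi g).
Proof.
move=> pc gc [M gM]; have M0 := expo_bounded_ge0 gM.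
apply: (@expo_bounded_intro _ _ _ (M * expo_moment M) M) => y.
rewrite mulrAC; apply: integral_normal_weight_le => //.
  exact: measurable_half_integrand.
by move=> t; exact: half_integrand_le.
Qed.

Lemma boundary_term_expo_bounded (R : realType) (d : nat) (j : 'I_d)
    (phi h : 'rV[R]_d -> R) :
  expo_bounded h -> expo_bounded (boundary_term j phi h).
Proof.
move=> [M hM]; have M0 := expo_bounded_ge0 hM.
have [C C0 CP] := expo_normal_pdf_bounded M0.
apply: (@expo_bounded_intro _ _ _ (M * C) M) => y; rewrite /boundary_term.
case: ifP => _; last by rewrite normr0 !mulr_ge0 ?expR_ge0.
set t := zero_coord _ _ _.
rewrite normrM (ger0_norm (normal_pdf_ge0 _ _ _)).
apply: (@le_trans _ _ (M * (expR (M * `|t|) * expR (M * eucl_norm y)) *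
    normal_pdf 0 1 t)).
  rewrite ler_wpM2r ?normal_pdf_ge0// (le_trans (hM _))// ler_wpM2l//.
  by rewrite -expRD ler_expR -mulrDr ler_wpM2l// eucl_norm_insert.
rewrite -[leRHS]mulrA -[leLHS]mulrA ler_wpM2l// mulrAC.
by rewrite ler_wpM2r ?expR_ge0.
Qed.

Lemma Cexpo_dword (R : realType) (n m : nat) (h : 'rV[R]_n -> R) (w : seq 'I_n) :
  Cexpo m h -> (size w <= m)%N -> Cexpo (m - size w) (dword w h).
Proof.
move=> hm; elim: w => [|i w IH] sw; first by rewrite subn0.
have := IH (ltnW sw); rewrite -[X in Cexpo X _]prednK ?subn_gt0//.
by move=> [_ /(_ i)[_]]; rewrite /= subnS.
Qed.

Lemma Cexpo_derivable (R : realType) (n m : nat) (h : 'rV[R]_n -> R) (i : 'I_n) :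
  (0 < m)%N -> Cexpo m h -> Cexpo m.-1 (partial i h).
Proof. by case: m => // m _ [_ /(_ i)[]]. Qed.

Lemma Cexpo_base (R : realType) (n m : nat) (h : 'rV[R]_n -> R) :
  Cexpo m h -> continuous h /\ expo_bounded h.
Proof. by case: m => [|m] []. Qed.

(** Every derivative of [half_integral j phi g] is the integral of the
    corresponding derivative of [g] plus a boundary term; each further derivation
    uses up one order of smoothness of the function [h] in the boundary term. *)
Lemma dword_half_integral (R : realType) (d r : nat) (j : 'I_d)
    (phi g : 'rV[R]_d -> R) (sg : R) :
  sg = 1 \/ sg = -1 -> (0 < r)%N -> Cexpo r phi -> Cexpo r g ->
  (forall x, 0 < sg * partial j phi x) ->
  expo_bounded (fun x => (partial j phi x)^-1) ->
  forall w : seq 'I_d.-1, (size w <= r)%N ->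
  exists h, [/\ Cexpo (r - size w) h, dword_exists w (half_integral j phi g) &
    dword w (half_integral j phi g) =
    fun y => half_integral j phi (dword (map (lift j) w) g) y +
             boundary_term j phi h y].
Proof.
move=> sg1 r0 phir gr pm pinv; elim => [|k w IH] sw.
  exists (fun=> 0); split => //; first exact: Cexpo_cst.
  apply/funext => y; rewrite /= /boundary_term.
  by case: ifP => _; rewrite ?mul0r addr0.
have [h [hC he hE]] := IH (ltnW sw).
have m0 : (0 < r - size w)%N by rewrite subn_gt0.
have m1 : (r - size (k :: w) = (r - size w).-1)%N by rewrite /= subnS.
have wC : Cexpo (r - size w) (dword (map (lift j) w) g).
  by rewrite -(size_map (lift j)); apply: Cexpo_dword => //; rewrite size_map ltnW.
have p1 : Cexpo 1 phi by exact: Cexpo_le phir.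
have h1 : Cexpo 1 h by exact: Cexpo_le hC.
have g1 : Cexpo 1 (dword (map (lift j) w) g) by exact: Cexpo_le wC.
have dI := fun y => half_integral_partial p1 sg1 pm pinv k y g1.
have dB := fun y => boundary_term_partial p1 sg1 pm pinv k y h1.
set u := fun x => sg * (dword (map (lift j) w) g x *
  (partial (lift j k) phi x / partial j phi x)) in dI.
set v := (fun x => partial (lift j k) h x - partial (lift j k) phi x /
  partial j phi x * (partial j h x - x 0 j * h x)) in dB.
exists (fun x => u x + v x).
have pr : (r - size (k :: w) <= r.-1)%N by rewrite -(subn1 r) leq_sub2l.
have pC (i : 'I_d) : Cexpo (r - size (k :: w)) (partial i phi).
  by apply: (Cexpo_le pr); exact: Cexpo_derivable.
have hC' (i : 'I_d) : Cexpo (r - size (k :: w)) (partial i h).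
  by rewrite m1; exact: Cexpo_derivable.
have hC1 : Cexpo (r - size (k :: w)) h by apply: Cexpo_le hC; rewrite m1 leq_pred.
have wC1 : Cexpo (r - size (k :: w)) (dword (map (lift j) w) g).
  by apply: Cexpo_le wC; rewrite m1 leq_pred.
have qC : Cexpo (r - size (k :: w))
    (fun x => partial (lift j k) phi x / partial j phi x).
  apply: CexpoM => //; apply: CexpoV => // x.
  by apply/eqP => e; have := pm x; rewrite e mulr0 ltxx.
split.
- apply: CexpoD; first by apply: CexpoZ; exact: CexpoM.
  apply: CexpoB => //; apply: CexpoM => //; apply: CexpoB => //.
  by apply: CexpoM => //; exact: Cexpo_coord.
- split => // y; rewrite hE.
  by apply: derivableD; [have [] := dI y|have [] := dB y].
- rewrite /= -/(dword _ _) hE; apply/funext => y.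
  have [dI1 dI2] := dI y; have [dB1 dB2] := dB y.
  rewrite /partial deriveD// -!/(partial _ _ _) dI2 dB2 -addrA.
  by rewrite boundary_termD.
Qed.

Lemma constant_sign (R : realType) (n : nat) (u : 'rV[R]_n -> R) :
  continuous u -> (forall x, u x <> 0) ->
  exists sg : R, (sg = 1 \/ sg = -1) /\ forall x, 0 < sg * u x.
Proof.
move=> uc u0; exists (Num.sg (u 0)); split.
  by case: sgrP; [move=> /u0|left|right].
move=> x; rewrite ltNge; apply/negP => ux.
(* Otherwise [u] would vanish on the segment from [0] to [x]. *)
pose f (t : R) := Num.sg (u 0) * u (t *: x).
have cf : continuous f.
  move=> t; apply: cvgM; first exact: cvg_cst.
  apply: (@continuous_comp _ _ _ (fun t : R => t *: x) u); last exact: uc.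
  by apply: cvgZr_tmp; exact: cvg_id.
have f0 : 0 < f 0 by rewrite /f scale0r -normrEsg normr_gt0; exact/eqP.
have f1 : f 1 <= 0 by rewrite /f scale1r.
have := @IVT R f 0 1 0 ler01 (continuous_subspaceT cf).
rewrite minEle maxEle [f 0 <= f 1]leNgt (le_lt_trans f1 f0)/= f1 (ltW f0).
move=> /(_ isT)[c _ fc].
have : `|f c| != 0.
  rewrite normrM normr_sg mulf_neq0 ?normr_eq0 ?pnatr_eq0 ?eqb0 ?negbK//.
    by exact/eqP.
  by exact/eqP.
by rewrite fc normr0 eqxx.
Qed.

(** Finitely many upward closed conditions on a constant hold simultaneously. *)
Lemma common_bound (R : realType) (I : finType) (P : I -> R -> Prop) :
  (forall i a b, a <= b -> P i a -> P i b) -> (forall i, exists a, P i a) ->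
  exists2 a, 0 < a & forall i, P i a.
Proof.
move=> mono /choice[a Pa]; exists (1 + \sum_i `|a i|).
  by rewrite ltr_pwDl// sumr_ge0.
move=> i; apply: mono (Pa i); rewrite (bigD1 i)//= addrCA ler_wpDr//.
  by rewrite addr_ge0// sumr_ge0.
exact: ler_norm.
Qed.

Unset Implicit Arguments.

Theorem theorem11 (R : realType) (d r : nat) (j : 'I_d)
    (f g phi : 'rV[R]_d -> R)
    (hr : (0 < r)%N)
    (hf : forall x, f x = g x * \1_[set z | 0 <= phi z] x)
    (hg : Cr r g) (hphi : Cr r phi)
    (hrd : (d <= r)%N)
    (hi : forall x, partial j phi x <> 0)
    (hii : exists L A : R, 0 < L /\ 0 < A /\
       forall (x : 'rV[R]_d) (b : nat) (alpha : 'I_d -> nat),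
         (1 <= b <= 2 * r - 1)%N -> (mdegree alpha <= r)%N ->
         Num.max `|mderiv alpha g x|
           (Num.max `|mderiv alpha phi x| (`|partial j phi x| ^- b))
         <= L * expR (A * eucl_norm x)) :
  (forall y : 'rV[R]_d.-1,
     (@lebesgue_measure R).-integrable setT
       (EFin \o preint_integrand j f y)) /\
  exists L' A' : R, 0 < L' /\ 0 < A' /\
    forall alpha : 'I_d -> nat, (mdegree alpha <= r)%N -> alpha j = 0%N ->
      mderiv_exists (fun k : 'I_d.-1 => alpha (lift j k)) (preint j f) /\
      forall y : 'rV[R]_d.-1,
        `|mderiv (fun k : 'I_d.-1 => alpha (lift j k)) (preint j f) y|
        <= L' * expR (A' * eucl_norm y).
Proof.
have [L [A [_ [_ hLA]]]] := hii.
have b1 : (1 <= 1 <= 2 * r - 1)%N.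
  by rewrite /= leq_subRL ?muln_gt0// addn1 -[X in (X <= _)%N](muln1 2) leq_mul2l.
have gr : Cexpo r g.
  apply: (Cr_Cexpo (L := L) (A := A) hg) => x alpha ha.
  apply: le_trans (hLA x 1%N alpha b1 ha).
  by rewrite le_max lexx.
have pr : Cexpo r phi.
  apply: (Cr_Cexpo (L := L) (A := A) hphi) => x alpha ha.
  apply: le_trans (hLA x 1%N alpha b1 ha).
  by rewrite !le_max lexx orbT.
have pinv : expo_bounded (fun x => (partial j phi x)^-1).
  apply: (@expo_bounded_intro _ _ _ L A) => x.
  have z0 : (mdegree (fun _ : 'I_d => 0%N) <= r)%N by rewrite /mdegree big1.
  apply: le_trans (hLA x 1%N _ b1 z0).
  by rewrite !le_max normfV expr1 lexx !orbT.
have [gc [G gb]] := Cexpo_base gr; have [pc _] := Cexpo_base pr.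
have [sg [sg1 pm]] : exists sg : R, (sg = 1 \/ sg = -1) /\
    forall x, 0 < sg * partial j phi x.
  apply: constant_sign => //.
  by have [] := Cexpo_base (Cexpo_derivable j hr pr).
have fE y t : preint_integrand j f y t =
    g (insert_coord j t y) * (0 <= phi (insert_coord j t y))%R%:R *
    normal_pdf 0 1 t.
  rewrite /preint_integrand hf indicE; congr (_ * _%:R * _).
  by congr nat_of_bool; apply/idP/idP; rewrite inE.
have fI : preint j f = half_integral j phi g.
  by apply/funext => y; apply: eq_Rintegral => t _; exact: fE.
have G0 := expo_bounded_ge0 gb.
split=> [y|].
  have -> : preint_integrand j f y = fun t => g (insert_coord j t y) *
      (0 <= phi (insert_coord j t y))%R%:R * normal_pdf 0 1 t.
    by apply/funext => t; exact: fE.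
  apply: (@integrable_normal_weight R (fun t => g (insert_coord j t y) *
    (0 <= phi (insert_coord j t y))%R%:R) (G * expR (G * eucl_norm y)) G) => //.
    exact: measurable_half_integrand.
  by move=> t; exact: half_integrand_le.
have dw := dword_half_integral sg1 hr pr gr pm pinv.
pose ok (alpha : 'I_d -> nat) := (mdegree alpha <= r)%N && (alpha j == 0%N).
have sz alpha : ok alpha -> (size (mword (fun k => alpha (lift j k))) <= r)%N.
  move=> /andP[ar /eqP aj]; apply: leq_trans ar.
  by rewrite size_mword /mdegree [X in (_ <= X)%N](bigD1_ord j)//= aj.
(* Multi-indices of degree at most [r] are finitely many, so one constant serves
   them all. *)
have [M M0 HM] : exists2 M, 0 < M & forall a : {ffun 'I_d -> 'I_r.+1},
    ok (fun i => a i : nat) -> forall y,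
    `|mderiv (fun k => a (lift j k) : nat) (half_integral j phi g) y| <=
    M * expR (M * eucl_norm y).
  apply: (@common_bound R _ (fun (a : {ffun 'I_d -> 'I_r.+1}) M =>
    ok (fun i => a i : nat) -> forall y,
    `|mderiv (fun k => a (lift j k) : nat) (half_integral j phi g) y| <=
    M * expR (M * eucl_norm y))).
    move=> a b c bc Hb oka y; have H := Hb oka.
    by rewrite (le_trans (H y))// expo_mono ?eucl_norm_ge0//; exact: expo_bounded_ge0 H.
  move=> a; have [oka|nok] := boolP (ok (fun i => a i : nat)); last by exists 0.
  have [h [hC _ hE]] := dw _ (sz _ oka).
  rewrite /mderiv hE.
  suff [M HM] : expo_bounded (fun y => half_integral j phi (dword
      (map (lift j) (mword (fun k => a (lift j k) : nat))) g) y +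
      boundary_term j phi h y) by exists M.
  have [hc hb] := Cexpo_base hC.
  have wC := @Cexpo_dword _ _ _ _
    (map (lift j) (mword (fun k => a (lift j k) : nat))) gr.
  rewrite size_map in wC; have [wc wb] := Cexpo_base (wC (sz _ oka)).
  apply: expo_boundedD; first exact: half_integral_expo_bounded.
  exact: boundary_term_expo_bounded.
exists M, M; do 2!split => //; move=> alpha ar aj; rewrite fI.
have oka : ok alpha by rewrite /ok ar aj eqxx.
have [_ [_ he _]] := dw _ (sz _ oka).
split => // y.
have al i : (alpha i < r.+1)%N.
  by rewrite ltnS (leq_trans _ ar)// /mdegree (bigD1 i)//= leq_addr.
have := HM [ffun i => Ordinal (al i)].
rewrite (_ : (fun i => _) = alpha); last by apply/funext => i; rewrite ffunE.
by rewrite (_ : (fun k => _) = (fun k => alpha (lift j k))); [apply|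
  apply/funext => k; rewrite ffunE].
Qed.
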